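(* Let $l,n\ge1$ and $e\ge2$ be integers and $\mathbf{s}=(s_1,\dots,s_l)\in\mathbb{Z}^l$. Let $\mathfrak{I}$ be the set of $i\in\{0,\dots,e-1\}$ such that $s_j\equiv i \pmod e$ for some $j\in\{1,\dots,l\}$, and for $k\in\mathfrak{I}$ let $\alpha(k)$ be the minimal element $c$ of $\{1,\dots,l\}$ such that $s_c\equiv k\pmod e$ and $s_c=\max\{s_j\mid 1\le j\le l,\ s_j\equiv k\pmod e\}$. Let $k\in\mathfrak{I}$. 1. If for all $k_1\in\mathfrak{I}$ with $k_1\neq k$ we have $$s_{\alpha(k)}>s_{\alpha(k_1)}\quad\text{or}\quad\big(s_{\alpha(k_1)}>s_{\alpha(k)}>s_{\alpha(k_1)}-e\ \text{ and }\ \alpha(k)<\alpha(k_1)\big),$$ then $[n,\alpha(k)]_{\theta_{\mathbf{s}}}=[n,\alpha(k)]$. 2. Otherwise, let $k_1\in\mathfrak{I}$ be such that $$s_{\alpha(k_1)}>s_{\alpha(k)}+e\quad\text{or}\quad\big(s_{\alpha(k_1)}>s_{\alpha(k)}>s_{\alpha(k_1)}-e\ \text{ and }\ \alpha(k_1)<\alpha(k)\big),$$ and such that the integer $j_{k_1}\in\{1,\dots,e-1\}$ with $j_{k_1}\equiv k_1-k\pmod e$ is minimal among all $k_1$ with this property. Then $$[n,\alpha(k)]_{\theta_{\mathbf{s}}}=\begin{cases}[n,\alpha(k)]&\text{if }n\le j_{k_1},\\ [j_{k_1},\alpha(k)]+[n-j_{k_1},\alpha(k_1)]_{\theta_{\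mathbf{s}}}&\text{otherwise.}\end{cases}$$
   Context: **Ariki-Koike algebra.** Let $A=\mathbb{C}[q^{\pm1},Q_1,\dots,Q_l]$ with $q,Q_1,\dots,Q_l$ indeterminates, and $K=\mathrm{Frac}(A)$. $\mathcal{H}$ (for a given $n$) is the associative $A$-algebra generated by $T_0,\dots,T_{n-1}$ with relations $(T_0-Q_1)\cdots(T_0-Q_l)=0$, $(T_i-q)(T_i+1)=0$ ($1\le i\le n-1$), $(T_0T_1)^2=(T_1T_0)^2$, $T_iT_{i+1}T_i=T_{i+1}T_iT_{i+1}$ ($1\le i\le n-2$), $T_iT_j=T_jT_i$ ($j\ge i+2$). An $l$-partition $\boldsymbol{\lambda}=(\lambda^1,\dots,\lambda^l)\vdash_l n$ is an $l$-tuple of partitions of total size $n$ (partitions are extended by infinitely many zero parts). The algebra $K\mathcal{H}$ is split semisimple with simple modules $KV^{\boldsymbol{\lambda}}$, $\boldsymbol{\lambda}\vdash_l n$; $KV^{\boldsymbol{\lambda}}$ is characterized by having a basis indexed by standard $\boldsymbol{\lambda}$-tableaux $\mathfrak{t}$ on which, for $1\le i\le n$, $L_i=q^{1-i}T_{i-1}\cdots T_1T_0T_1\cdots T_{i-1}$ acts by the scalar $Q_cq^{b-a}$, where $(a,b,c)$ (row $a$, column $b$, component $c$) is the node containing $i$ in $\mathfrak{t}$. $V^{\boldsymbol{\lambda}}$ denotes an $\mathcal{H}$-module, free of finite rank over $A$, with $K\otimes_AV^{\boldsymbol{\lambda}}\simeq KV^{\boldsymbol{\lambda}}$. **One dimensional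 modules.** $[n,j]$ is the $l$-partition with $j$-th component $(n)$ and all other components empty; $V^{[n,j]}$ is the one dimensional module $T_0\mapsto Q_j$, $T_i\mapsto q$ ($i\ge1$). **Specialization.** Let $\eta\in\mathbb{C}$ be a primitive $e$-th root of $1$; $\theta_{\mathbf{s}}:A\to\mathbb{C}$ sends $q\mapsto\eta$, $Q_j\mapsto\eta^{s_j}$. $\mathbb{C}_{\theta_{\mathbf{s}}}\mathcal{H}$ and $\mathbb{C}_{\theta_{\mathbf{s}}}V^{\boldsymbol{\lambda}}$ are the specializations; $[\mathbb{C}_{\theta_{\mathbf{s}}}V^{\boldsymbol{\lambda}}:M]$ is the composition multiplicity of a simple module $M$ (independent of the choice of $V^{\boldsymbol{\lambda}}$). **Labels of simple modules.** Choose rationals $v_1<v_2<\dots<v_l<v_1+e$ and put $m_j=s_j-v_j$. For $\boldsymbol{\lambda}\vdash_l n$ let $\kappa_1(\boldsymbol{\lambda})\ge\kappa_2(\boldsymbol{\lambda})\ge\cdots$ be the elements of the multiset $\{\lambda^c_a-a+m_c\mid 1\le c\le l,\ a\ge1\}$ in weakly decreasing order. Write $\boldsymbol{\mu}\ll\boldsymbol{\lambda}$ if $\boldsymbol{\mu}=\boldsymbol{\lambda}$, or if $\kappa(\boldsymbol{\mu})\ne\kappa(\boldsymbol{\lambda})$ and $\sum_{i\le t}\kappa_i(\boldsymbol{\mu})\le\sum_{i\le t}\kappa_i(\boldsymbol{\lambda})$ for all $t\ge1$. It is known that for each simple $\mathbb{C}_{\theta_{\mathbf{s}}}\mathcal{H}$-module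 $M$ there is a unique $\boldsymbol{\lambda}_M\vdash_l n$ with $[\mathbb{C}_{\theta_{\mathbf{s}}}V^{\boldsymbol{\lambda}_M}:M]=1$ and such that $[\mathbb{C}_{\theta_{\mathbf{s}}}V^{\boldsymbol{\mu}}:M]\ne0$ implies $\boldsymbol{\mu}\ll\boldsymbol{\lambda}_M$; moreover $M\mapsto\boldsymbol{\lambda}_M$ is injective and does not depend on the choice of the $v_j$. **Notation.** If $V^{\boldsymbol{\lambda}}$ is one dimensional, $\boldsymbol{\lambda}_{\theta_{\mathbf{s}}}:=\boldsymbol{\lambda}_M$ for the simple module $M=\mathbb{C}_{\theta_{\mathbf{s}}}V^{\boldsymbol{\lambda}}$ (for $[n-j_{k_1},\alpha(k_1)]_{\theta_{\mathbf{s}}}$ the algebra is the one for $n-j_{k_1}$ in place of $n$). The sum of two $l$-partitions is componentwise and partwise: $(\boldsymbol{\mu}+\boldsymbol{\nu})^c_a=\mu^c_a+\nu^c_a$. *)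

(* Defs.v *)
From HB Require Import structures.
From mathcomp Require Import all_boot all_order all_algebra.
From mathcomp Require Import boolp classical_sets reals complex.
From mathcomp Require Import mpoly.

Set Implicit Arguments.
Unset Strict Implicit.
Unset Printing Implicit Defensive.

Import Order.TTheory GRing.Theory Num.Theory.
Local Open Scope ring_scope.

(* Everything is 0-based: c : 'I_l stands for the component c + 1 of an
   l-partition (and for Q_(c+1), s_(c+1), v_(c+1)), and the rows and columns
   of a component are numbered from 0. *)

(* In C[q, Q_1, ..., Q_l], C = R[i], the variable of index ord0 is q and the
   variable of index lift ord0 c is Q_c. *)
Notation Cpoly R l := {mpoly (R[i])[l.+1]}.
Notation Kfrac R l := {fraction (Cpoly R l)}.

Lemma subf_div (F : fieldType) (x a y b : F) : a != 0 -> b != 0 ->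
  x / a - y / b = (x * b - y * a) / (a * b).
Proof. by move=> a0 b0; rewrite -!mulNr addf_div. Qed.

Section GroundRing.
Variables (R : realType) (l : nat).

Definition polq : Cpoly R l := 'X_ord0.

(* A = C[q, q^-1, Q_1, ..., Q_l], as the subring of K = C(q, Q_1, ..., Q_l)
   of the p / q^m; K is also the fraction field of A. *)
Definition is_laurent : {pred Kfrac R l} :=
  [pred x | `[< exists pm : Cpoly R l * nat,
                x = tofrac pm.1 / tofrac polq ^+ pm.2 >]].

Lemma laurentP x : reflect (exists pm : Cpoly R l * nat,
  x = tofrac pm.1 / tofrac polq ^+ pm.2) (x \in is_laurent).
Proof. exact: asboolP. Qed.

Lemma polq_neq0 : tofrac polq != 0 :> Kfrac R l.
Proof.
rewrite tofrac_eq0 /polq; apply/eqP => X0.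
have := mcoeffXU R[i] (@ord0 l) ord0; rewrite X0 mcoeff0 eqxx => /eqP.
by rewrite eq_sym oner_eq0.
Qed.

Lemma is_laurent_subring : subring_closed is_laurent.
Proof.
split; first by apply/laurentP; exists (1, 0%N); rewrite tofrac1 expr0 divr1.
- move=> _ _ /laurentP[[p m] ->] /laurentP[[p' m'] ->]; apply/laurentP.
  exists (p * polq ^+ m' - p' * polq ^+ m, (m + m')%N) => /=.
  rewrite tofracB !tofracM !tofracXn exprD.
  by rewrite subf_div // expf_neq0 // polq_neq0.
- move=> _ _ /laurentP[[p m] ->] /laurentP[[p' m'] ->]; apply/laurentP.
  exists (p * p', (m + m')%N) => /=.
  by rewrite tofracM exprD mulf_div.
Qed.

HB.instance Definition _ :=
  GRing.isSubringClosed.Build (Kfrac R l) is_laurent is_laurent_subring.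

Record laurent := Laurent {
  laurent_val : Kfrac R l;
  laurent_valP : laurent_val \in is_laurent }.

HB.instance Definition _ := [isSub for laurent_val].
HB.instance Definition _ := [Choice of laurent by <:].
HB.instance Definition _ := [SubChoice_isSubComNzRing of laurent by <:].

Lemma laurent_polyP (p : Cpoly R l) : tofrac p \in is_laurent.
Proof. by apply/laurentP; exists (p, 0%N); rewrite expr0 divr1. Qed.

Definition laurent_poly (p : Cpoly R l) : laurent :=
  Laurent (laurent_polyP p).

Definition qA : laurent := laurent_poly polq.
Definition QA (c : 'I_l) : laurent := laurent_poly 'X_(lift ord0 c).

Section Specialization.
Variables (eta : R[i]) (s : 'I_l -> int).

Definition spec_point (i : 'I_l.+1) : R[i] :=
  if unlift ord0 i is Some c then eta ^ s c else eta.

Definition theta (x : laurent) : R[i] :=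
  let pm := sval (cid (elimT (laurentP (laurent_val x)) (laurent_valP x))) in
  pm.1.@[spec_point] / eta ^+ pm.2.

Hypothesis eta_neq0 : eta != 0.

Lemma theta_frac (x : laurent) p m :
  laurent_val x = tofrac p / tofrac polq ^+ m ->
  theta x = p.@[spec_point] / eta ^+ m.
Proof.
rewrite /theta; case: cid => -[p' m'] /= -> /eqP.
rewrite eqr_div ?expf_neq0 ?polq_neq0 // -!tofracXn -!tofracM tofrac_eq.
move=> /eqP /(congr1 (meval spec_point)); rewrite !mevalM !rmorphXn /=.
rewrite mevalXU /spec_point unlift_none => E.
by apply/eqP; rewrite eqr_div ?expf_neq0 // E.
Qed.

Lemma theta_zmod_morphism : zmod_morphism theta.
Proof.
move=> x y.
have /laurentP[[p m] /= xE] := laurent_valP x.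
have /laurentP[[p' m'] /= yE] := laurent_valP y.
rewrite (theta_frac xE) (theta_frac yE).
rewrite (@theta_frac _ (p * polq ^+ m' - p' * polq ^+ m) (m + m')%N).
  rewrite mevalB !mevalM !rmorphXn /= mevalXU /spec_point unlift_none exprD.
  by rewrite subf_div // expf_neq0.
rewrite -[LHS]/(val (x - y)) rmorphB /= xE yE.
by rewrite tofracB !tofracM !tofracXn exprD subf_div // expf_neq0 // polq_neq0.
Qed.

Lemma theta_monoid_morphism : monoid_morphism theta.
Proof.
split; first by rewrite (@theta_frac 1 1 0) ?meval1 ?divr1 // tofrac1 divr1.
move=> x y.
have /laurentP[[p m] /= xE] := laurent_valP x.
have /laurentP[[p' m'] /= yE] := laurent_valP y.
rewrite (theta_frac xE) (theta_frac yE).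
rewrite (@theta_frac _ (p * p') (m + m')%N).
  by rewrite mevalM exprD mulf_div.
by rewrite -[LHS]/(val (x * y)) rmorphM /= xE yE tofracM exprD mulf_div.
Qed.

Lemma theta_poly p : theta (laurent_poly p) = p.@[spec_point].
Proof. by rewrite (@theta_frac _ p 0) ?divr1. Qed.

Lemma theta_const a : theta (laurent_poly a%:MP) = a.
Proof. by rewrite theta_poly mevalC. Qed.

Lemma theta_q : theta qA = eta.
Proof. by rewrite theta_poly mevalXU /spec_point unlift_none. Qed.

Lemma theta_Q c : theta (QA c) = eta ^ s c.
Proof. by rewrite theta_poly mevalXU /spec_point liftK. Qed.

End Specialization.
End GroundRing.

(* A module, free of rank rdim, given by the matrices of T_0, T_1, ...;
   for the algebra of rank n only T_0, ..., T_(n-1) are ever considered.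
   Elements of modules are row vectors, on which T_i acts by v |-> v *m T_i;
   right and left modules are the same thing, because the defining relations
   (and the elements L_i) are invariant under reversal of products. *)
Record mxmod (F : Type) := MxMod {
  rdim : nat;
  ract :> nat -> 'M[F]_rdim }.

Definition map_mxmod (F G : Type) (f : F -> G) (V : mxmod F) : mxmod G :=
  MxMod (fun i => map_mx f (V i)).

(* The defining relations of the Ariki-Koike algebra of rank n. *)
Definition AK_relations (F : comNzRingType) (l n : nat) (q : F)
    (Q : 'I_l -> F) (V : mxmod F) : Prop :=
  [/\ (0 < n)%N -> \prod_(c < l) (V 0%N - (Q c)%:M) = 0,
      forall i, (1 <= i < n)%N -> (V i - q%:M) * (V i + 1) = 0,
      (1 < n)%N -> (V 0%N * V 1%N) ^+ 2 = (V 1%N * V 0%N) ^+ 2,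
      forall i, (1 <= i)%N -> (i.+1 < n)%N ->
        V i * V i.+1 * V i = V i.+1 * V i * V i.+1 &
      forall i j, (i.+2 <= j < n)%N -> V i * V j = V j * V i].

Section FieldRepr.
Variables (F : fieldType) (n : nat).

(* Subspaces are row spaces of square matrices. *)
Definition submodule (V : mxmod F) (U : 'M[F]_(rdim V)) : Prop :=
  forall i, (i < n)%N -> stablemx U (V i).

Definition simple_mxmod (V : mxmod F) : Prop :=
  (0 < rdim V)%N /\
  forall U : 'M[F]_(rdim V), submodule U -> U = 0 \/ row_full U.

(* W / U is isomorphic to M: there is an equivariant linear map f on W, onto
   M, with kernel U. *)
Definition quotient_iso (V : mxmod F) (U W : 'M[F]_(rdim V)) (M : mxmod F) :
    Prop :=
  exists f : 'M[F]_(rdim V, rdim M),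
    [/\ forall i, (i < n)%N -> W *m (V i *m f) = W *m (f *m M i),
        row_full (W *m f) &
        (W :&: kermx f :=: U)%MS].

(* 0 < W_1 < ... < W_r = V, given as the sequence W_1, ..., W_r. *)
Definition composition_series (V : mxmod F) (Ws : seq 'M[F]_(rdim V)) : Prop :=
  row_full (last 0 Ws) /\
  forall i, (i < size Ws)%N ->
    let U := nth 0 (0 :: Ws) i in
    let W := nth 0 Ws i in
    [/\ submodule W, (U < W)%MS &
        forall X : 'M[F]_(rdim V), submodule X ->
          (U <= X)%MS -> (X <= W)%MS -> (X <= U)%MS \/ (W <= X)%MS].

(* [V : M], counted in some composition series of V. *)
Definition comp_mult (V M : mxmod F) : nat :=
  let Ws : seq 'M[F]_(rdim V) :=
    xget [::] [set Ws | composition_series (V := V) Ws]%classic in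
  count (fun i => `[< quotient_iso (nth 0 (0 :: Ws) i) (nth 0 Ws i) M >])%R
        (iota 0 (size Ws)).

End FieldRepr.

(* l-tuples of partitions, a partition being the sequence of its nonzero
   parts; the part of index a is nth 0 _ a, which is 0 beyond the end. *)
Section Multipartitions.
Variable l : nat.

Definition mpart := {ffun 'I_l -> seq nat}.

Definition part (la : mpart) (c : 'I_l) (a : nat) : nat := nth 0%N (la c) a.

Definition is_mpart (n : nat) (la : mpart) : Prop :=
  (forall c, sorted geq (la c) /\ 0%N \notin la c) /\
  (\sum_(c < l) sumn (la c))%N = n.

Definition mpart_add (mu nu : mpart) : mpart :=
  [ffun c => mkseq (fun a => part mu c a + part nu c a)%N
                   (maxn (size (mu c)) (size (nu c)))].

(* [n, j]; there is no nonzero part if n = 0. *)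
Definition mrow (n : nat) (j : 'I_l) : mpart :=
  [ffun c => if c == j then nseq (0 < n)%N n else [::]].

(* The node in row x.1.1, column x.1.2, component x.2. *)
Definition node : Type := nat * nat * 'I_l.

Definition in_diagram (la : mpart) (x : node) : bool :=
  (x.1.2 < part la x.2 x.1.1)%N.

(* A tableau of shape la of size n is given by the map i |-> node containing
   i + 1; as there are n nodes, this is a bijection as soon as it is
   injective. *)
Definition standard (n : nat) (la : mpart) (t : {ffun 'I_n -> node}) : Prop :=
  [/\ injective t,
      forall i, in_diagram la (t i) &
      forall i j : 'I_n, (t i).2 = (t j).2 ->
        ((t i).1.1 = (t j).1.1 /\ ((t i).1.2 < (t j).1.2)%N) \/
        ((t i).1.2 = (t j).1.2 /\ ((t i).1.1 < (t j).1.1)%N) ->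
        (i < j)%N].

End Multipartitions.

(* The Jucys-Murphy element
   L_(i+1) = q^-i T_i ... T_1 T_0 T_1 ... T_i, for i >= 0. *)
Definition jucys_murphy (F : fieldType) (q : F) (V : mxmod F) (i : nat) :
    'M[F]_(rdim V) :=
  q ^- i *: ((\prod_(1 <= k < i.+1) V (i.+1 - k)%N) * V 0%N *
             (\prod_(1 <= k < i.+1) V k)).

(* W is a simple module with a basis b_0, ..., b_(d-1) (the rows of P)
   indexed by the standard tableaux t_0, ..., t_(d-1) of shape la, and
   b_r L_(i+1) = Q_c q^(b-a) b_r if t_r has i + 1 in the node (a, b, c). *)
Definition is_KV (F : fieldType) (l n : nat) (q : F) (Q : 'I_l -> F)
    (la : mpart l) (W : mxmod F) : Prop :=
  [/\ AK_relations n q Q W, simple_mxmod n W &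
    exists (ts : (rdim W).-tuple {ffun 'I_n -> node l}) (P : 'M[F]_(rdim W)),
      [/\ uniq ts, forall t, t \in ts <-> standard la t, P \in unitmx &
        forall (r : 'I_(rdim W)) (i : 'I_n),
          let x := tnth ts r i in
          row r P *m jucys_murphy q W i =
            (Q x.2 * q ^ (x.1.2%:Z - x.1.1%:Z)) *: row r P]].

Section Labels.
Variables (R : realType) (l : nat).

(* V is a V^la: an H-module, free of finite rank over A, with
   K (x) V isomorphic to KV^la. *)
Definition is_V (n : nat) (la : mpart l) (V : mxmod (laurent R l)) : Prop :=
  AK_relations n (@qA R l) (@QA R l) V /\
  is_KV n (laurent_val (@qA R l)) (fun c => laurent_val (@QA R l c)) la
    (map_mxmod (@laurent_val R l) V).

Variables (s : 'I_l -> int) (v : 'I_l -> rat).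

(* kappa la i is the element of index i of the multiset of all
   la^c_a - a + m_c. It is enough to sort those which come from the first
   i + 1 rows: any other element has at least i + 1 larger ones, from the
   same component. *)
Definition kappa (la : mpart l) (i : nat) : rat :=
  nth 0 (sort >=%R
    [seq (part la c a)%:R - a.+1%:R + ((s c)%:~R - v c)
       | c <- enum 'I_l, a <- iota 0 i.+1]) i.

Definition dominated (mu la : mpart l) : Prop :=
  mu = la \/
  ((exists i, kappa mu i <> kappa la i) /\
   forall t, \sum_(i < t) kappa mu i <= \sum_(i < t) kappa la i).

Variables (eta : R[i]) (V : nat -> mpart l -> mxmod (laurent R l)).

Definition CV (n : nat) (la : mpart l) : mxmod R[i] :=
  map_mxmod (theta eta s) (V n la).

Definition is_label (n : nat) (M : mxmod R[i]) (la : mpart l) : Prop :=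
  [/\ is_mpart n la,
      comp_mult n (CV n la) M = 1%N &
      forall mu, is_mpart n mu ->
        comp_mult n (CV n mu) M <> 0%N -> dominated mu la].

(* la_M; the default value, the empty l-partition, is not of size n > 0. *)
Definition label (n : nat) (M : mxmod R[i]) : mpart l :=
  xget [ffun=> [::]] [set la | is_label n M la]%classic.

(* la_theta, for V^la of rank one. *)
Definition theta_label (n : nat) (la : mpart l) : mpart l :=
  label n (CV n la).

End Labels.

Section Residues.
Variables (l e : nat) (s : 'I_l -> int).

(* The set I of residues mod e of the s_j. *)
Definition res_set (k : nat) : Prop :=
  (k < e)%N /\ exists j, (s j = k%:Z %[mod e%:Z])%Z.

Definition is_alpha (k : nat) (c : 'I_l) : Prop :=
  let P c := (s c = k%:Z %[mod e%:Z])%Z /\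
             forall j, (s j = k%:Z %[mod e%:Z])%Z -> s j <= s c in
  P c /\ forall c', P c' -> (c <= c')%N.

(* The representative of k1 - k mod e in {1, ..., e-1}, for distinct
   k, k1 < e. *)
Definition res_diff (k k1 : nat) : nat :=
  `|((k1%:Z - k%:Z) %% e%:Z)%Z|%N.

End Residues.

(* Main.v *)
Require Import Defs.
From HB Require Import structures.
From mathcomp Require Import all_boot all_order all_algebra.
From mathcomp Require Import boolp classical_sets reals complex.
From mathcomp Require Import mpoly.
From mathcomp Require Import zify ring lra.

(** Put m_c = s_c - v_c. The one dimensional module M = [n, alpha(k)] has the
    residue sequence k, k+1, ..., k+n-1, so it can only occur in V^mu if some
    standard mu-tableau t has this residue sequence. Adding a node in row a and
    column b of the component c raises an entry of kappa to m_c + b - a. The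
    tableau that always adds the node with the largest value occupies first
    rows only; its shape la is the l-partition of the statement, because the
    condition on k_1 says that the first node of the component alpha(k_1) has
    a larger value than the next node of the component alpha(k). By induction
    on i, the i-th value of t is at most the i-th value of the greedy tableau,
    hence kappa(mu) is dominated by kappa(la), and equality forces t to be the
    greedy tableau, as |v_c - v_d| < e excludes ties.

    So the weight space of V^la for this residue sequence is a line, and it
    remains to see that M is the composition factor containing it. Let b in
    KV^la be a vector of the weight of the greedy tableau. Then T_j b = q b if
    j and j+1 are in the same row, the T_w b, for w minimal in its coset of the
    row stabilizer, form a basis of KV^la, and the A-lattice that they span has
    M as a quotient after specialization, through T_w b |-> eta^l(w). For a
    product X of elements L_i - a that is of rank one on KV^la, the scalar a_h
    in X h X = a_h X does not depend on the lattice, so that this quotient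
    determines its specialization on every V^la. *)

Set Implicit Arguments.
Unset Strict Implicit.
Unset Printing Implicit Defensive.

Import Order.TTheory GRing.Theory Num.Theory.
Local Open Scope ring_scope.

(** * Permutation modules *)

Section PermutationModule.
Local Open Scope nat_scope.
Variables (L : eqType) (rho : L -> nat) (n : nat) (w0 : nat -> L).

(** Words are functions on [nat], pinned to [w0] from position [n] on, so that equal words are equal
    functions. The simple reflection of index [j] acts on the positions [j.-1] and [j], counted from
    0. *)
Definition wswap (j : nat) (w : nat -> L) : nat -> L :=
  fun i => if i == j then w j.-1 else if i == j.-1 then w j else w i.

Definition rearrangement (w : nat -> L) : Prop :=
  (forall i, n <= i -> w i = w0 i) /\ perm_eq (mkseq w n) (mkseq w0 n).

Definition descent (j : nat) (w : nat -> L) : bool :=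
  rho (w j) < rho (w j.-1).

(** A substitute for the number of inversions: it drops whenever a descent is undone. *)
Definition wmeasure (w : nat -> L) : nat := \sum_(i < n) (n - i) * rho (w i).

Lemma wswap_far i j w : 0 < i -> i.+1 < j ->
  wswap i (wswap j w) = wswap j (wswap i w).
Proof.
move=> i0 ij; apply/funext => k; rewrite /wswap.
by repeat (case: eqP => ?; try lia); subst.
Qed.

Lemma wswap_braid j w : 0 < j ->
  wswap j (wswap j.+1 (wswap j w)) = wswap j.+1 (wswap j (wswap j.+1 w)).
Proof.
move=> j0; apply/funext => k; rewrite /wswap /=.
by repeat (case: eqP => ?; try lia); subst.
Qed.

Lemma rearrangement_refl : rearrangement w0. Proof. by []. Qed.

Lemma rearrangement_swap j w : 0 < j < n ->
  rearrangement w -> rearrangement (wswap j w).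
Proof.
case/andP=> j0 jn [wn wp]; split=> [i ni|].
  by rewrite /wswap -wn //; case: eqP => [|_]; [lia | case: eqP => //; lia].
apply: perm_trans wp.
have split_seq v : mkseq v n =
    mkseq v j.-1 ++ [:: v j.-1; v j] ++ [seq v i | i <- iota j.+1 (n - j.+1)].
  rewrite /mkseq -[in LHS](subnKC (_ : j.-1 <= n)); last by lia.
  rewrite iotaD map_cat; congr (_ ++ _).
  by rewrite add0n (_ : n - j.-1 = (n - j.+1).+2) /= ?prednK //; lia.
rewrite !split_seq perm_sym.
rewrite (_ : mkseq (wswap j w) _ = mkseq w j.-1); last first.
  apply/eq_in_map => i; rewrite mem_iota /wswap => ?.
  by case: eqP => [|_]; [lia | case: eqP => //; lia].
rewrite (_ : [seq wswap j w i | i <- _] = [seq w i | i <- iota j.+1 (n - j.+1)]); last first.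
  apply/eq_in_map => i; rewrite mem_iota /wswap => ?.
  by case: eqP => [|_]; [lia | case: eqP => //; lia].
rewrite perm_cat2l perm_cat2r /wswap eqxx.
rewrite (_ : (j.-1 == j) = false) ?eqxx; last by apply/eqP; lia.
by rewrite -[[:: w j.-1; w j]]/([:: w j.-1] ++ [:: w j]) perm_catC.
Qed.

Lemma wmeasure_swap j w : 0 < j < n -> descent j w ->
  wmeasure (wswap j w) < wmeasure w.
Proof.
case/andP=> j0 jn desc; have j1n : j.-1 < n by lia.
have ne : Ordinal jn != Ordinal j1n by apply/eqP => -[]; lia.
rewrite /wmeasure.
rewrite [X in X < _](bigD1 (Ordinal jn)) //= [X in _ < X](bigD1 (Ordinal jn)) //=.
rewrite [X in _ + X < _](bigD1 (Ordinal j1n)) ?[X in _ < _ + X](bigD1 (Ordinal j1n)) /=;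
  try by rewrite eq_sym.
rewrite (eq_bigr (fun i : 'I_n => (n - i) * rho (w i))); last first.
  move=> i /andP[/eqP i1 /eqP i2]; rewrite /wswap.
  case: eqP => [e|_]; first by case: i1; apply: val_inj.
  by case: eqP => // e; case: i2; apply: val_inj.
rewrite !addnA ltn_add2r /wswap eqxx (_ : (j.-1 == j) = false) ?eqxx; last by apply/eqP; lia.
have -> : n - j.-1 = (n - j).+1 by lia.
by move: desc; rewrite /descent !mulSn; nia.
Qed.

Hypothesis w0_sorted : forall j, 0 < j < n -> rho (w0 j.-1) <= rho (w0 j).
Hypothesis rho_inj : forall i i', i < n -> i' < n ->
  rho (w0 i) = rho (w0 i') -> w0 i = w0 i'.

Lemma rearrangement_letter w i : rearrangement w -> i < n ->
  exists2 i', i' < n & w i = w0 i'.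
Proof.
move=> [_ wp] lti; have /mapP[i' ] : w i \in mkseq w0 n.
  by rewrite -(perm_mem wp); apply/mapP; exists i; rewrite // mem_iota.
by rewrite mem_iota => /andP[_ lti'] ->; exists i'.
Qed.

Lemma rearrangement_rho_inj w i i' : rearrangement w -> i < n -> i' < n ->
  rho (w i) = rho (w i') -> w i = w i'.
Proof.
move=> rw /(rearrangement_letter rw)[k kn ->] /(rearrangement_letter rw)[k' kn' ->].
exact: rho_inj.
Qed.

(** Without descents the ranks are sorted, and two sorted sequences with the same entries agree;
    [rho_inj] leads from the ranks back to the letters. *)
Lemma no_descent w : rearrangement w ->
  (forall j, 0 < j < n -> ~~ descent j w) -> w = w0.
Proof.
move=> [wn wp] nodesc.
have sortedP v : (forall j, 0 < j < n -> rho (v j.-1) <= rho (v j)) ->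
    sorted leq (mkseq (rho \o v) n).
  move=> vs; apply/(sortedP 0) => i; rewrite size_mkseq => lti.
  by rewrite !nth_mkseq //=; [exact: (vs i.+1) | lia].
have pm : perm_eq (mkseq (rho \o w) n) (mkseq (rho \o w0) n).
  by rewrite /mkseq (map_comp rho w) (map_comp rho w0); exact: perm_map.
have E : mkseq (rho \o w) n = mkseq (rho \o w0) n.
  apply: (sorted_eq leq_trans anti_leq) pm; apply: sortedP => //.
  by move=> j /nodesc; rewrite /descent -leqNgt.
apply/funext => i; have [lti|] := ltnP i n; last exact: wn.
have [i' lti' wi] := rearrangement_letter (conj wn wp) lti.
rewrite wi; apply: rho_inj => //.
by have := congr1 (fun s => nth 0 s i) E; rewrite !nth_mkseq //= wi.
Qed.

Lemma rearrangement_ind (P : (nat -> L) -> Prop) : P w0 ->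
  (forall w j, rearrangement w -> 0 < j < n -> descent j w ->
     P (wswap j w) -> P w) ->
  forall w, rearrangement w -> P w.
Proof.
move=> P0 Pw w; have [m] := ubnP (wmeasure w); elim: m w => // m IH w ltm rw.
have [[j [jn desc]]|nodesc] := pselect (exists j, 0 < j < n /\ descent j w).
  apply: (Pw w j) => //; apply: IH; last exact: rearrangement_swap.
  by have := wmeasure_swap jn desc; lia.
rewrite (no_descent rw) // => j jn; apply/negP => desc; apply: nodesc.
by exists j.
Qed.

Variables (X : Type) (T : nat -> X -> X) (qs : X -> X) (b : X).
Hypothesis T_qs : forall j x, 0 < j < n -> T j (qs x) = qs (T j x).
Hypothesis T_braid : forall j x, 0 < j -> j.+1 < n ->
  T j (T j.+1 (T j x)) = T j.+1 (T j (T j.+1 x)).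
Hypothesis T_comm : forall i j x, 0 < i -> i.+1 < j < n ->
  T i (T j x) = T j (T i x).
Hypothesis T_b : forall j, 0 < j < n -> w0 j.-1 = w0 j -> T j b = qs b.

(** This is T_w b, built by undoing one descent at a time, with [m] as fuel. The set [X] is abstract
    and [qs] stands for multiplication by q, so that one construction yields both the vectors T_w b
    and the values of a linear form on them. *)
Fixpoint word_vec_rec (m : nat) (w : nat -> L) : X :=
  if m is m'.+1 then
    if [pick d : 'I_n | (0 < d) && descent d w] is Some d
    then T d (word_vec_rec m' (wswap d w)) else b
  else b.

Definition word_vec (w : nat -> L) : X := word_vec_rec (wmeasure w) w.

Lemma word_vec_recE m m' w : wmeasure w <= m -> wmeasure w <= m' ->
  word_vec_rec m w = word_vec_rec m' w.
Proof.
elim: m m' w => [|m IH] [|m'] w //= le le'; case: pickP => // d /andP[d0 desc].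
- by have := @wmeasure_swap d w; rewrite d0 ltn_ord => /(_ isT desc); lia.
- by have := @wmeasure_swap d w; rewrite d0 ltn_ord => /(_ isT desc); lia.
- have := @wmeasure_swap d w; rewrite d0 ltn_ord => /(_ isT desc) lt.
  by congr (T d _); apply: IH; lia.
Qed.

Lemma word_vecP w :
  (exists d, [/\ 0 < d < n, descent d w & word_vec w = T d (word_vec (wswap d w))])
  \/ ((forall j, 0 < j < n -> ~~ descent j w) /\ word_vec w = b).
Proof.
have [[j [jn desc]]|nodesc] := pselect (exists j, 0 < j < n /\ descent j w).
  left; rewrite {1}/word_vec.
  have := wmeasure_swap jn desc; case E : (wmeasure w) => [|m] // _ /=.
  case: pickP => [d /andP[d0 descd]|]; last first.
    by move/(_ (Ordinal (proj2 (andP jn)))); rewrite /= desc (proj1 (andP jn)).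
  have dn : 0 < d < n by rewrite d0 ltn_ord.
  exists d; split=> //; congr (T d _); apply: word_vec_recE => //.
  by have := wmeasure_swap dn descd; rewrite E ltnS.
right; split.
  by move=> j jn; apply/negP => desc; apply: nodesc; exists j.
rewrite /word_vec; case: (wmeasure w) => //= m; case: pickP => // d /andP[d0 desc].
by case: nodesc; exists d; rewrite d0 ltn_ord.
Qed.

Lemma wswap_out j w i : i <> j -> i <> j.-1 -> wswap j w i = w i.
Proof. by move=> /eqP/negPf ne /eqP/negPf ne'; rewrite /wswap ne ne'. Qed.

Lemma wswap_l j w : wswap j w j = w j.-1.
Proof. by rewrite /wswap eqxx. Qed.

Lemma wswap_r j w : 0 < j -> wswap j w j.-1 = w j.
Proof.
by move=> j0; rewrite /wswap eqxx (_ : (j.-1 == j) = false) //; apply/eqP; lia.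
Qed.

Lemma word_vec0 : word_vec w0 = b.
Proof.
case: (word_vecP w0) => [[d [dn desc _]]|[_ //]].
by have := w0_sorted dn; move: desc; rewrite /descent; lia.
Qed.

(* This is Matsumoto's lemma for the minimal coset representatives of the
   stabilizer of [w0]. *)
Lemma word_vec_spec w : rearrangement w -> forall j, 0 < j < n ->
  (descent j w -> word_vec w = T j (word_vec (wswap j w))) /\
  (w j.-1 = w j -> T j (word_vec w) = qs (word_vec w)).
Proof.
have [m] := ubnP (wmeasure w); elim: m w => // m IH w ltm rw j jn.
case: (word_vecP w) => [[d [dn descd Ew]]|[nodesc Ew]]; last first.
  split=> [desc|wj]; first by have := nodesc _ jn; rewrite desc.
  by rewrite Ew; apply: T_b => //; rewrite -(no_descent rw nodesc).
have rd := rearrangement_swap dn rw; have md := wmeasure_swap dn descd.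
have [-> {j jn}|jd] := eqVneq j d.
  by split=> // wd; move: descd; rewrite /descent wd ltnn.
have {IH}IH v : wmeasure v < wmeasure w -> rearrangement v -> forall j, 0 < j < n ->
  (descent j v -> word_vec v = T j (word_vec (wswap j v))) /\
  (v j.-1 = v j -> T j (word_vec v) = qs (word_vec v)).
  by move=> lt; apply: IH; lia.
have IHd := IH _ md rd.
(* [d] is the descent at which [word_vec w] was unfolded. If [j] and [d] are not adjacent, T_j and
   T_d commute, and so do the two swaps. *)
have [near|far] := boolP ((j == d.+1) || (d == j.+1)); last first.
  have [jl jr] : wswap d w j = w j /\ wswap d w j.-1 = w j.-1.
    by split; apply: wswap_out; lia.
  have TT x : T j (T d x) = T d (T j x).
    have [lt|ge] := ltnP j d; first by apply: T_comm; lia.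
    by symmetry; apply: T_comm; lia.
  have ss : wswap j (wswap d w) = wswap d (wswap j w).
    have [lt|ge] := ltnP j d; first by apply: wswap_far; lia.
    by symmetry; apply: wswap_far; lia.
  split=> [desc|wj].
    have := (IHd j jn).1; rewrite /descent jl jr => /(_ desc) E.
    rewrite Ew E ss -TT; congr (T j _); symmetry.
    have mj := wmeasure_swap jn desc.
    apply: (IH _ mj (rearrangement_swap jn rw) d dn).1.
    by rewrite /descent !wswap_out //; lia.
  by rewrite Ew TT (IHd j jn).2 ?jl ?jr // T_qs.
case/orP: near => /eqP jE; subst.
- have d1 : wswap d w d = w d.-1 by rewrite wswap_l.
  have d2 : wswap d w d.-1 = w d by rewrite wswap_r //; lia.
  have d3 : wswap d w d.+1 = w d.+1 by rewrite wswap_out //; lia.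
  split=> [desc|/= wj].
  (* Three strictly decreasing letters: starting with either descent, three swaps lead to the same
     word, and the braid relation identifies the two products. *)
  + have mj := wmeasure_swap jn desc; have rj := rearrangement_swap jn rw.
    have desc1 : descent d.+1 (wswap d w).
      by rewrite /descent /= d1 d3; move: desc descd; rewrite /descent /=; lia.
    have desc2 : descent d (wswap d.+1 (wswap d w)).
      by rewrite /descent wswap_r //= d3 wswap_out ?d2 //; lia.
    have m1 := wmeasure_swap jn desc1; have r1 := rearrangement_swap jn rd.
    have desc3 : descent d (wswap d.+1 w).
      rewrite /descent wswap_r //= wswap_out; [|lia..].
      by move: desc descd; rewrite /descent /=; lia.
    have desc4 : descent d.+1 (wswap d (wswap d.+1 w)).
      rewrite /descent /= wswap_l wswap_out; [|lia..].
      by rewrite wswap_l wswap_out //; lia.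
    have m3 := wmeasure_swap dn desc3; have r3 := rearrangement_swap dn rj.
    rewrite Ew (IHd _ jn).1 // (IH _ (ltn_trans m1 md) r1 d dn).1 //.
    rewrite (IH _ mj rj d dn).1 // (IH _ (ltn_trans m3 mj) r3 _ jn).1 //.
    by rewrite T_braid ?wswap_braid //; lia.
  (* A larger letter before two equal ones: the braid relation turns T_(d+1) into T_d acting on a
     shorter word, where the equal letters stand at [d.-1] and [d]. *)
  + have desc1 : descent d.+1 (wswap d w).
      by rewrite /descent /= d1 d3 -wj; move: descd; rewrite /descent.
    have m1 := wmeasure_swap jn desc1; have r1 := rearrangement_swap jn rd.
    rewrite Ew (IHd _ jn).1 // -T_braid; [|lia..].
    rewrite (IH _ (ltn_trans m1 md) r1 d dn).2; first by rewrite !T_qs.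
    by rewrite wswap_r //= d3 wswap_out ?d2 //; lia.
- have j0 : 0 < j by lia.
  have d1 : wswap j.+1 w j.+1 = w j by rewrite wswap_l.
  have d2 : wswap j.+1 w j = w j.+1 by rewrite wswap_r.
  have d3 : wswap j.+1 w j.-1 = w j.-1 by rewrite wswap_out //; lia.
  split=> [desc|/= wj].
  + have mj := wmeasure_swap jn desc; have rj := rearrangement_swap jn rw.
    have desc1 : descent j (wswap j.+1 w).
      by rewrite /descent /= d2 d3; move: desc descd; rewrite /descent /=; lia.
    have desc2 : descent j.+1 (wswap j (wswap j.+1 w)).
      rewrite /descent /= wswap_l d3 wswap_out ?d1; [|lia..].
      by move: desc descd; rewrite /descent /=; lia.
    have m1 := wmeasure_swap jn desc1; have r1 := rearrangement_swap jn rd.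
    have desc3 : descent j.+1 (wswap j w).
      rewrite /descent /= wswap_l wswap_out; [|lia..].
      by move: desc descd; rewrite /descent /=; lia.
    have desc4 : descent j (wswap j.+1 (wswap j w)).
      rewrite /descent /= (wswap_r (j := j.+1)) // wswap_out; [|lia..].
      by rewrite wswap_out ?wswap_r //; lia.
    have m3 := wmeasure_swap dn desc3; have r3 := rearrangement_swap dn rj.
    rewrite Ew (IHd _ jn).1 // (IH _ (ltn_trans m1 md) r1 _ dn).1 //.
    rewrite (IH _ mj rj _ dn).1 // (IH _ (ltn_trans m3 mj) r3 _ jn).1 //.
    by rewrite -T_braid ?wswap_braid //; lia.
  + have desc1 : descent j (wswap j.+1 w).
      by rewrite /descent /= d2 d3 wj; move: descd; rewrite /descent.
    have m1 := wmeasure_swap jn desc1; have r1 := rearrangement_swap jn rd.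
    rewrite Ew (IHd _ jn).1 // T_braid; [|lia..].
    rewrite (IH _ (ltn_trans m1 md) r1 _ dn).2; first by rewrite !T_qs.
    by rewrite /= wswap_l d3 wswap_out ?d1 //; lia.
Qed.

End PermutationModule.

(** * Words and composition multiplicities *)

Section Words.
Variable F : comNzRingType.

Definition ev (V : mxmod F) (w : seq nat) : 'M[F]_(rdim V) :=
  foldr (fun i X => V i *m X) 1%:M w.

Lemma ev_cat V w1 w2 : ev V (w1 ++ w2) = ev V w1 *m ev V w2.
Proof. by elim: w1 => [|i w1 IH] /=; rewrite ?mul1mx // IH mulmxA. Qed.

(* A pair [(w, a)] stands for the element [T_w - a] of the algebra, and a
   sequence of pairs for a product of such elements. *)
Definition pev (V : mxmod F) (p : seq (seq nat * F)) : 'M[F]_(rdim V) :=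
  foldr (fun x X => (ev V x.1 - x.2%:M) *m X) 1%:M p.

Definition chiw (chi : nat -> F) (w : seq nat) : F := \prod_(i <- w) chi i.

Definition pchi (chi : nat -> F) (p : seq (seq nat * F)) : F :=
  \prod_(x <- p) (chiw chi x.1 - x.2).

Definition pwords (n : nat) (p : seq (seq nat * F)) : bool :=
  all (fun x => all (ltn^~ n) x.1) p.

End Words.

Section WordsMorphism.
Variables (F G : comNzRingType) (f : {rmorphism F -> G}).

Definition pmap_coef (p : seq (seq nat * F)) : seq (seq nat * G) :=
  [seq (x.1, f x.2) | x <- p].

Lemma map_ev V w : map_mx f (ev V w) = ev (map_mxmod f V) w.
Proof. by elim: w => [|i w IH] /=; rewrite ?map_mx1 // map_mxM IH. Qed.

Lemma map_pev V p : map_mx f (pev V p) = pev (map_mxmod f V) (pmap_coef p).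
Proof.
elim: p => [|x p IH] /=; rewrite ?map_mx1 // map_mxM IH.
by rewrite map_mxB map_ev map_scalar_mx.
Qed.

Lemma pwords_map n p : pwords n (pmap_coef p) = pwords n p.
Proof. by rewrite /pwords all_map. Qed.

End WordsMorphism.

Section Subspaces.
Variable F : fieldType.

(** A row space of maximal rank inside [P] is all of [P], since any further vector of [P] could be
    added to it. *)
Lemma subspace_mx d (P : 'rV[F]_d -> Prop) : P 0 ->
  (forall a x y, P x -> P y -> P (a *: x + y)) ->
  exists U : 'M[F]_d, forall x, (x <= U)%MS <-> P x.
Proof.
move=> P0 Plin.
pose good r := `[< exists U : 'M[F]_d,
  (forall x, (x <= U)%MS -> P x) /\ \rank U = r >].
have ex_good : exists r, good r.
  exists 0%N; apply/asboolP; exists 0; split; last by rewrite mxrank0.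
  by move=> x; rewrite submx0 => /eqP->.
have ub r : good r -> (r <= d)%N.
  by move=> /asboolP[U [_ <-]]; exact: rank_leq_row.
case: (ex_maxnP ex_good ub) => r /asboolP[U [UP rU]] rmax.
exists U => x; split; first exact: UP.
move=> Px; apply: contrapT => xU.
have : good (\rank (U + x)%MS).
  apply/asboolP; exists (U + x)%MS; split=> // y /sub_addsmxP[[u1 u2] /= ->].
  have /sub_rVP[a ->] : (u2 *m x <= x)%MS by exact: submxMl.
  by rewrite addrC; apply: Plin => //; apply: UP; exact: submxMl.
move=> /rmax; rewrite -rU => le; apply: xU.
have /mxrank_leqif_sup [_] := addsmxSl U x.
rewrite eqn_leq mxrankS ?addsmxSl // le => /esym.
by rewrite addsmx_sub submx_refl.
Qed.

End Subspaces.

Section CompositionMultiplicity.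
Variables (F : fieldType) (n : nat).

(** By induction on the codimension of [U]: a submodule of least rank strictly above [U] leaves no
    room for a submodule in between. *)
Lemma composition_series_above (V : mxmod F) (U : 'M[F]_(rdim V)) :
  submodule n U -> exists Ws : seq 'M[F]_(rdim V),
  row_full (last U Ws) /\
  forall i, (i < size Ws)%N ->
    [/\ submodule n (nth 0 Ws i), (nth 0 (U :: Ws) i < nth 0 Ws i)%MS &
        forall X : 'M[F]_(rdim V), submodule n X ->
          (nth 0 (U :: Ws) i <= X)%MS -> (X <= nth 0 Ws i)%MS ->
          (X <= nth 0 (U :: Ws) i)%MS \/ (nth 0 Ws i <= X)%MS].
Proof.
have [m] := ubnP (rdim V - \rank U)%N; elim: m U => // m IH U leU subU.
have [fullU|nfullU] := boolP (row_full U); first by exists [::].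
have ltU : (\rank U < rdim V)%N.
  by rewrite ltn_neqAle rank_leq_col andbT.
pose good r := `[< exists W : 'M[F]_(rdim V),
  [/\ submodule n W, (U < W)%MS & \rank W = r] >].
have ex_good : exists r, good r.
  exists (rdim V); apply/asboolP; exists 1%:M; split; last exact: mxrank1.
    by move=> i _; exact: submx1.
  by rewrite ltmxE submx1 sub1mx.
case: (ex_minnP ex_good) => r /asboolP[W [subW UW rW]] rmin.
have ltUW : (\rank U < \rank W)%N by exact: rank_ltmx.
case: (IH W) => // [|Ws [lastW WsP]]; first by lia.
exists (W :: Ws); split=> // -[_|i]; last by rewrite ltnS => /WsP.
split=> //= X subX UX XW.
have [XU|nXU] := boolP (X <= U)%MS; [by left | right].
have : good (\rank X).
  by apply/asboolP; exists X; split=> //; rewrite ltmxE UX.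
move=> /rmin; rewrite -rW => le.
have /mxrank_leqif_sup [_] := XW.
by rewrite eqn_leq mxrankS // le => /esym ->.
Qed.

Lemma composition_series_ex (V : mxmod F) :
  exists Ws : seq 'M[F]_(rdim V), composition_series (V := V) n Ws.
Proof.
case: (@composition_series_above V 0) => [i _|Ws WsP]; last by exists Ws.
by rewrite mul0mx sub0mx.
Qed.

Variables (V M : mxmod F) (chi : nat -> F).
Hypothesis dimM : rdim M = 1%N.
Hypothesis actM : forall i, (i < n)%N -> M i = (chi i)%:M.

Lemma submodule_ev (U : 'M[F]_(rdim V)) w (x : 'rV_(rdim V)) :
  submodule n U -> all (ltn^~ n) w -> (x <= U)%MS -> (x *m ev V w <= U)%MS.
Proof.
move=> subU; elim: w x => [|i w IH] x /=; first by rewrite mulmx1.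
case/andP=> lti ltw xU; rewrite mulmxA; apply: IH => //.
by apply: submx_trans (subU i lti); exact: submxMr.
Qed.

Lemma submodule_pev (U : 'M[F]_(rdim V)) p (x : 'rV_(rdim V)) :
  submodule n U -> pwords n p -> (x <= U)%MS -> (x *m pev V p <= U)%MS.
Proof.
move=> subU; elim: p x => [|[w a] p IH] x /=; first by rewrite mulmx1.
case/andP=> ltw ltp xU; rewrite mulmxA; apply: IH => //.
rewrite mulmxBr mul_mx_scalar; apply: addmx_sub; first exact: submodule_ev.
by rewrite eqmx_opp scalemx_sub.
Qed.

Section Equivariant.
Variables (W : 'M[F]_(rdim V)) (f : 'M[F]_(rdim V, rdim M)).
Hypothesis subW : submodule n W.
Hypothesis equiv : forall i, (i < n)%N -> W *m (V i *m f) = W *m (f *m M i).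

Lemma equiv_ev w (x : 'rV_(rdim V)) : all (ltn^~ n) w -> (x <= W)%MS ->
  x *m ev V w *m f = chiw chi w *: (x *m f).
Proof.
elim: w x => [|i w IH] x /=; first by rewrite mulmx1 /chiw big_nil scale1r.
case/andP=> lti ltw xW; rewrite mulmxA IH //; last first.
  by apply: submx_trans (subW lti); exact: submxMr.
rewrite /chiw big_cons.
case/submxP: xW => y ->; rewrite -!mulmxA equiv // actM //.
by rewrite mul_mx_scalar -!scalemxAr scalerA mulrC.
Qed.

Lemma equiv_pev p (x : 'rV_(rdim V)) : pwords n p -> (x <= W)%MS ->
  x *m pev V p *m f = pchi chi p *: (x *m f).
Proof.
elim: p x => [|[w a] p IH] x /=; first by rewrite mulmx1 /pchi big_nil scale1r.
case/andP=> ltw ltp xW; rewrite mulmxA IH //; last first.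
  have := @submodule_pev W [:: (w, a)] x subW; rewrite /= mulmx1 andbT.
  by apply.
rewrite /pchi big_cons mulmxBr mul_mx_scalar mulmxBl equiv_ev // -scalemxAl.
by rewrite -scalerBl scalerA mulrC.
Qed.

Lemma full_nonzero : row_full (W *m f) ->
  exists2 x : 'rV_(rdim V), (x <= W)%MS & x *m f != 0.
Proof.
move=> full; have nz : W *m f != 0.
  by apply/eqP => Wf0; move: full; rewrite Wf0 /row_full mxrank0 dimM.
have /rowV0Pn[y /submxP[z ->] nz'] := nz.
by exists (z *m W); rewrite ?submxMl // -mulmxA.
Qed.

End Equivariant.

Let Ws : seq 'M[F]_(rdim V) :=
  xget [::] [set Ws | composition_series (V := V) n Ws]%classic.

Lemma chosen_series : composition_series (V := V) n Ws.
Proof.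
exact: (@xgetPex _ [::] [set Ws | composition_series (V := V) n Ws]%classic
  (composition_series_ex V)).
Qed.

(** An element that kills [V] kills its composition factors, and on [M] it is the scalar
    [pchi chi p]. *)
Lemma comp_mult_neq0 p : comp_mult n V M <> 0%N -> pwords n p ->
  pev V p = 0 -> pchi chi p = 0.
Proof.
move=> /eqP; rewrite /comp_mult -lt0n -has_count => /hasP[j].
rewrite mem_iota => /andP[_ ltiW] /asboolP[f [equiv full _]] ltp p0.
have [_ /(_ j ltiW)[subW _ _]] := chosen_series.
have [x xW nz] := full_nonzero full.
have := equiv_pev subW equiv ltp xW; rewrite p0 mulmx0 mul0mx => /esym/eqP.
by rewrite scaler_eq0 (negPf nz) orbF => /eqP.
Qed.


Lemma count_jumps (g : nat -> bool) N : ~~ g 0%N ->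
  (forall i, (i < N)%N -> g i -> g i.+1) ->
  count (fun i => g i.+1 && ~~ g i) (iota 0 N) = g N.
Proof.
move=> g0; elim: N => [|N IH] mono; first by rewrite (negPf g0).
rewrite -addn1 iotaD count_cat IH => [|i /ltnW]; last exact: mono.
rewrite /= add0n addn0 addn1.
by case: (g N) (mono N (ltnSn N)) => [/(_ isT)->|_]; rewrite ?andbF ?andbT.
Qed.

(** As [X] is of rank one, it is a column [phi] times a row [w]. A factor isomorphic to [M] must be
    the one at which [w] enters the series, because [X] acts on [M] by a nonzero scalar and its
    image is the line of [w]. Conversely, [phi] identifies the factor at which [w] enters with
    [M]. *)
Lemma comp_mult_one p (X := pev V p) : pwords n p ->
  (forall i j i' j', X i j * X i' j' = X i j' * X i' j) -> X != 0 ->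
  pchi chi p != 0 ->
  (forall h, all (ltn^~ n) h ->
     X *m ev V h *m X = (pchi chi p * chiw chi h) *: X) ->
  comp_mult n V M = 1%N.
Proof.
move=> ltp minors Xn0 c0 Xh.
have [i0 [j0 Xij]] : exists i0 j0, X i0 j0 != 0.
  apply: contrapT => noX; case/negP: Xn0; apply/eqP/matrixP => i j.
  rewrite mxE; apply: contrapT => /eqP nz; by apply: noX; exists i, j.
pose w := row i0 X; pose phi := (X i0 j0)^-1 *: col j0 X.
have XE : X = phi *m w.
  apply/matrixP => i j; rewrite -scalemxAl !mxE big_ord1 !mxE.
  by rewrite minors mulrCA mulVf ?mulr1 // minors.
have wh h : all (ltn^~ n) h ->
    w *m ev V h *m phi = (pchi chi p * chiw chi h)%:M.
  move=> lth.
  have : phi *m (w *m ev V h *m phi) *m w = (pchi chi p * chiw chi h) *: X.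
    by rewrite -Xh // XE !mulmxA.
  rewrite [w *m _ *m phi]mx11_scalar; set a := (w *m _ *m _) 0 0.
  rewrite mul_mx_scalar -scalemxAl -XE.
  by move/matrixP/(_ i0 j0); rewrite ![(_ *: X) _ _]mxE => /(mulIf Xij) <-.
have wphi : w *m phi = (pchi chi p)%:M.
  by have := wh [::] isT; rewrite /= mulmx1 /chiw big_nil mulr1.
clearbody phi w.
have [lastW WsP] := chosen_series.
pose g i := (w <= nth 0%R (0%R :: Ws) i)%MS.
have wn0 : w != 0.
  apply/eqP => w0; move: wphi; rewrite w0 mul0mx => /matrixP/(_ 0 0).
  by rewrite !mxE eqxx => /esym/eqP; rewrite (negPf c0).
have gS : g (size Ws).
  rewrite /g; have -> : nth 0 (0 :: Ws) (size Ws) = last 0 Ws by rewrite -last_nth.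
  by rewrite submx_full.
rewrite /comp_mult -/Ws; transitivity (g (size Ws) : nat); last by rewrite gS.
have gmono i : (i < size Ws)%N -> g i -> g i.+1.
  move=> /WsP[_ UW _]; rewrite /g /= => /submx_trans; apply; exact: ltmxW.
(* [w] enters the series exactly once, so it suffices to compare the two counted properties factor
   by factor. *)
rewrite -(count_jumps _ gmono); last by rewrite /g /= submx0.
apply: eq_in_count => i; rewrite mem_iota add0n => /andP[_ lti].
apply/asboolP/andP => [[f [equiv full ker]]|[wW wU]].
  have [subW UW _] := WsP i lti.
  have [x xW xf] := full_nonzero full.
  have /eqP := equiv_pev subW equiv ltp xW.
  have [a aE] : exists a, x *m phi = a%:M by exists ((x *m phi) 0 0); exact: mx11_scalar.
  rewrite -/X XE mulmxA aE mul_scalar_mx -scalemxAl => /eqP E.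
  have nz : a *: (w *m f) != 0 by rewrite E scaler_eq0 negb_or c0.
  have [a0 wf] : a != 0 /\ w *m f != 0 by apply/andP; rewrite -negb_or -scaler_eq0.
  have := submodule_pev subW ltp xW; rewrite -/X XE mulmxA aE mul_scalar_mx.
  rewrite (eqmx_scale _ a0) => wW; split; first exact: wW.
  apply/negP => wU; case/negP: wf.
  have : (w <= kermx f)%MS.
    by apply: (submx_trans wU); rewrite -ker capmxSr.
  by move/sub_kermxP => ->.
have [subW UW maxU] := WsP i lti.
rewrite /g /= in wW wU.
set W := nth 0 Ws i in wW subW UW maxU *; set U := nth 0 (0 :: Ws) i in wU UW maxU *.
have subU : submodule n U.
  rewrite /U; case: i lti {wW wU subW UW maxU W U} => [|i] lti /=.
    by move=> j _; rewrite mul0mx sub0mx.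
  by have [] := WsP i (ltnW lti).
have phiU (x : 'rV_(rdim V)) : (x <= U)%MS -> x *m phi = 0.
  move=> xU; have := submodule_pev subU ltp xU; rewrite -/X XE mulmxA.
  rewrite [x *m phi]mx11_scalar mul_scalar_mx => h.
  have [->|nz] := eqVneq ((x *m phi) 0 0) 0; first by rewrite raddf0.
  by move: h; rewrite (eqmx_scale _ nz) (negPf wU).
(* Simplicity of W / U for subspaces given by predicates: such a [P] meets [W] in [U] or in all of
   [W]. *)
have stable_case (P : 'rV_(rdim V) -> Prop) : P 0 ->
    (forall a x y, P x -> P y -> P (a *: x + y)) ->
    (forall j x, (j < n)%N -> P x -> P (x *m V j)) ->
    (forall x, (x <= U)%MS -> P x) ->
    ((exists2 x, (x <= W)%MS & ~ P x) -> forall x, (x <= W)%MS -> P x -> (x <= U)%MS) /\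
    ((exists x, [/\ (x <= W)%MS, P x & ~~ (x <= U)%MS]) -> forall x, (x <= W)%MS -> P x).
  move=> P0 Plin PV PU; have [Y YP] := subspace_mx P0 Plin.
  have subY : submodule n Y.
    move=> j ltj; apply/row_subP => r; rewrite row_mul.
    by apply/YP/PV => //; apply/YP/row_sub.
  have UY : (U <= Y)%MS by apply/row_subP => r; apply/YP/PU/row_sub.
  have := maxU (W :&: Y)%MS; case.
  - move=> j ltj; rewrite sub_capmx; apply/andP; split.
      by apply: submx_trans (subW j ltj); apply: submxMr; exact: capmxSl.
    by apply: submx_trans (subY j ltj); apply: submxMr; exact: capmxSr.
  - by rewrite sub_capmx UY ltmxW.
  - exact: capmxSl.
  - move=> le; split=> [_ x xW Px|[x [xW Px]]].
      by apply: submx_trans le; rewrite sub_capmx xW; apply/YP.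
    by case/negP; apply: submx_trans le; rewrite sub_capmx xW; apply/YP.
  - rewrite sub_capmx submx_refl /= => WY; split=> [[x xW nP]|_ x xW].
      by case: nP; apply/YP; apply: submx_trans WY.
    by apply/YP; apply: submx_trans WY.
have phi_ev (x : 'rV_(rdim V)) h : (x <= W)%MS -> all (ltn^~ n) h ->
    x *m ev V h *m phi = chiw chi h *: (x *m phi).
  move=> xW lth.
  (* The prefix [h1] makes [P] stable under the action. [P] contains [U], where [phi] vanishes, and
     [w], hence all of [W]. *)
  pose P (x : 'rV_(rdim V)) := forall h1 h2, all (ltn^~ n) h1 -> all (ltn^~ n) h2 ->
    x *m ev V (h1 ++ h2) *m phi = chiw chi h2 *: (x *m ev V h1 *m phi).
  have [||||_ PW] := stable_case P.
  - by move=> h1 h2 _ _; rewrite !mul0mx scaler0.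
  - move=> a y z Py Pz h1 h2 l1 l2; rewrite !mulmxDl -!scalemxAl Py // Pz //.
    by rewrite scalerDr !scalerA mulrC.
  - move=> j y ltj Py h1 h2 l1 l2; have := Py (j :: h1) h2; rewrite /= ltj l1.
    by rewrite !mulmxA => ->.
  - move=> y yU h1 h2 l1 l2; rewrite !phiU ?scaler0 //; apply: submodule_ev => //.
    by rewrite all_cat l1.
  have := PW _ x xW [::] h isT lth; rewrite /= mulmx1; apply.
  exists w; split=> // h1 h2 l1 l2; rewrite !wh ?all_cat ?l1 //.
  by rewrite scale_scalar_mx /chiw big_cat /=; congr (_%:M); ring.
have kerphi (x : 'rV_(rdim V)) : (x <= W)%MS -> x *m phi = 0 -> (x <= U)%MS.
  (* The largest submodule in the kernel of [phi]; as it misses [w], it meets [W] in [U]. *)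
  pose P (x : 'rV_(rdim V)) := forall h, all (ltn^~ n) h -> x *m ev V h *m phi = 0.
  have [||||PU _] := stable_case P.
  - by move=> h _; rewrite !mul0mx.
  - by move=> a y z Py Pz h l; rewrite !mulmxDl -!scalemxAl Py // Pz // scaler0 addr0.
  - by move=> j y ltj Py h l; have := Py (j :: h); rewrite /= ltj l mulmxA; apply.
  - by move=> y yU h l; apply: phiU; exact: submodule_ev.
  move=> xW x0; apply: PU => // [|h l]; last by rewrite phi_ev // x0 scaler0.
  exists w => //; move/(_ [::] isT); rewrite /= mulmx1 wphi => /matrixP/(_ 0 0).
  by rewrite !mxE => /eqP; rewrite (negPf c0).
exists (castmx (erefl, esym dimM) phi).
have castE m k (A : 'M_(m, k)) (B : 'M_(k, 1)) :
    A *m castmx (erefl, esym dimM) B = castmx (erefl, esym dimM) (A *m B).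
  by case: _ / (esym dimM).
have cast0 m (A : 'M_(m, 1)) : castmx (erefl, esym dimM) A = 0 <-> A = 0.
  by case: _ / (esym dimM); rewrite castmx_id.
split.
- move=> j ltj; rewrite actM // mul_mx_scalar -scalemxAr !castE.
  apply/row_matrixP => r; rewrite linearZ /=.
  have := phi_ev (row r W) [:: j] (row_sub _ _); rewrite /= andbT mulmx1 => /(_ ltj).
  rewrite /chiw big_seq1 -!row_mul.
  by case: _ / (esym dimM); rewrite !castmx_id mulmxA.
- rewrite castE; have : row_full (W *m phi).
    have : ~~ (W *m phi == 0).
      apply/eqP => W0; have := wphi; case/submxP: wW => y ->.
      rewrite -mulmxA W0 mulmx0 => /matrixP/(_ 0 0); rewrite !mxE => /esym/eqP.
      by rewrite (negPf c0).
    by rewrite /row_full -mxrank_eq0 -lt0n; have := rank_leq_col (W *m phi); case: (\rank _) => [|[]].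
  by case: _ / (esym dimM); rewrite castmx_id.
- apply/eqmxP/andP; split.
    apply/rV_subP => x; rewrite sub_capmx => /andP[xW /sub_kermxP].
    by rewrite castE => /cast0 x0; exact: kerphi.
  rewrite sub_capmx ltmxW //=; apply/rV_subP => x xU; apply/sub_kermxP.
  by rewrite castE; apply/cast0; exact: phiU.
Qed.

End CompositionMultiplicity.

(** * Jucys-Murphy elements *)

(* The word of q^i L_(i+1). *)
Definition jword (i : nat) : seq nat := rev (iota 1 i) ++ 0%N :: iota 1 i.

Lemma jwordS i : jword i.+1 = i.+1 :: rcons (jword i) i.+1.
Proof.
rewrite /jword; have -> : iota 1 i.+1 = rcons (iota 1 i) i.+1 by rewrite -cats1 -(iotaD 1 i 1) addn1.
by rewrite rev_rcons /= -rcons_cons rcons_cat.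
Qed.

Lemma jword_lt n i : (i < n)%N -> all (ltn^~ n) (jword i).
Proof.
move=> ltin; rewrite /jword all_cat all_rev /=.
have -> : all (ltn^~ n) (iota 1 i).
  by apply/allP => x; rewrite mem_iota => ?; rewrite /=; lia.
by rewrite /=; lia.
Qed.

Lemma chiw_jword (F : comNzRingType) (chi : nat -> F) (q : F) n i :
  (forall j, (1 <= j < n)%N -> chi j = q) -> (i < n)%N ->
  chiw chi (jword i) = chi 0%N * q ^+ i.*2.
Proof.
move=> chiq; elim: i => [|i IH] ltin.
  by rewrite /chiw big_seq1 expr0 mulr1.
rewrite jwordS /chiw big_cons big_rcons /= -/(chiw _ _) IH; last exact: ltnW.
by rewrite chiq ?doubleS ?exprS //; ring.
Qed.

Section JucysMurphy.
Variables (F : comNzRingType) (l n : nat) (q : F) (Q : 'I_l -> F) (W : mxmod F).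
Hypothesis relW : AK_relations n q Q W.

Lemma ev_jwordS i :
  ev W (jword i.+1) = W i.+1 *m ev W (jword i) *m W i.+1.
Proof. by rewrite jwordS /= -cats1 ev_cat /= mulmx1 mulmxA. Qed.

Lemma quad j : (1 <= j < n)%N -> W j *m W j = (q - 1) *: W j + q%:M.
Proof.
move=> jn; have [_ /(_ j jn) E _ _ _] := relW; move: E.
rewrite -mulmxE mulmxDr mulmx1 mulmxBl mul_scalar_mx => /eqP.
rewrite addr_eq0 => /eqP/(canRL (subrK _)) ->.
by apply/matrixP => a b; rewrite !mxE; ring.
Qed.

Lemma braid j : (1 <= j)%N -> (j.+1 < n)%N ->
  W j *m W j.+1 *m W j = W j.+1 *m W j *m W j.+1.
Proof. by move=> j1 jn; have [_ _ _ /(_ j j1 jn)] := relW; rewrite -mulmxE. Qed.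

Lemma far_comm i j : (i.+2 <= j < n)%N -> W i *m W j = W j *m W i.
Proof. by move=> ij; have [_ _ _ _ /(_ i j ij)] := relW; rewrite -mulmxE. Qed.

Lemma jm_comm_small i j : (i < j.-1)%N -> (j < n)%N ->
  W j *m ev W (jword i) = ev W (jword i) *m W j.
Proof.
elim: i => [|i IH] ij jn; first by rewrite /= mulmx1 (far_comm (i := 0%N)) //; lia.
have C : W i.+1 *m W j = W j *m W i.+1 by apply: far_comm; lia.
rewrite ev_jwordS !mulmxA -C -(mulmxA (W i.+1) (W j)) IH; [|lia..].
by rewrite -!mulmxA C.
Qed.

Lemma jm_comm_big i j : (0 < j < i)%N -> (i < n)%N ->
  W j *m ev W (jword i) = ev W (jword i) *m W j.
Proof.
elim: i => [|i IH]; first by rewrite ltn0 andbF.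
(* For neighbouring indices the braid relation turns T_j on the left into T_(j+1), which passes the
   inner Jucys-Murphy element and is turned back into T_j on the right. *)
case/andP=> j0; rewrite ltnS leq_eqVlt => /orP[/eqP jE|ji] lti.
  clear IH; case: j j0 jE => // j _ jE; subst i.
  rewrite !ev_jwordS !mulmxA braid // -!mulmxA.
  have -> : W j.+1 *m (W j.+2 *m W j.+1) = W j.+2 *m (W j.+1 *m W j.+2).
    by rewrite !mulmxA braid.
  rewrite (mulmxA (W j.+2) (ev W _)) jm_comm_small //.
  by rewrite !mulmxA.
have C : W j *m W i.+1 = W i.+1 *m W j by apply: far_comm; lia.
rewrite ev_jwordS !mulmxA C -(mulmxA (W i.+1) (W j)) IH; [|lia..].
by rewrite -!mulmxA C.
Qed.

Lemma jm_comm i j : (0 < j < n)%N -> (i < n)%N -> i != j -> i.+1 != j ->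
  W j *m ev W (jword i) = ev W (jword i) *m W j.
Proof.
move=> j0 ltin ij ij'; have [lt|ge] := ltnP i j.
  by apply: jm_comm_small; lia.
by apply: jm_comm_big; lia.
Qed.

(** Without the power of q, the next Jucys-Murphy element is T J T, so that one quadratic relation
    suffices to move T across; [T_jm_pred] uses it on the right-hand factor. *)
Lemma T_jm j : (j.+1 < n)%N -> W j.+1 *m ev W (jword j.+1) =
  (q - 1) *: ev W (jword j.+1) + q *: (ev W (jword j) *m W j.+1).
Proof.
move=> jn; rewrite ev_jwordS !mulmxA quad // mulmxDl mulmxDl.
by rewrite mul_scalar_mx -!scalemxAl.
Qed.

Lemma T_jm_pred j : (j.+1 < n)%N -> q *: (W j.+1 *m ev W (jword j)) =
  ev W (jword j.+1) *m W j.+1 - (q - 1) *: ev W (jword j.+1).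
Proof.
move=> jn; rewrite ev_jwordS -[in RHS]mulmxA quad // mulmxDr mul_mx_scalar.
by rewrite -scalemxAr addrC addKr.
Qed.

End JucysMurphy.

Lemma jucys_murphyE (F : fieldType) (q : F) (W : mxmod F) i :
  jucys_murphy q W i = q ^- i *: ev W (jword i).
Proof.
rewrite /jucys_murphy; congr (_ *: _); elim: i => [|i IH].
  by rewrite !big_geq // mul1r mulr1 /= mulmx1.
rewrite ev_jwordS -IH [X in _ * X]big_nat_recr //= -!mulmxE !mulmxA.
rewrite [X in X *m _ *m _ *m _]big_ltn // subn1 /=.
rewrite [X in W i.+1 *m X *m _ *m _](_ : _ = \prod_(1 <= k < i.+1) W (i.+1 - k)%N) -?mulmxE ?mulmxA //.
rewrite big_add1 /=; apply: eq_big_nat => k /andP[k1 k2]; congr (W _); lia.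
Qed.

Lemma AK_relations_map (F G : comNzRingType) (f : {rmorphism F -> G}) l n
    (q : F) (Q : 'I_l -> F) (V : mxmod F) :
  AK_relations n q Q V -> AK_relations n (f q) (f \o Q) (map_mxmod f V).
Proof.
have mapM (X Y : 'M[F]_(rdim V)) : map_mx f (X * Y) = map_mx f X * map_mx f Y.
  by rewrite -mulmxE map_mxM.
move=> [r1 r2 r3 r4 r5]; split.
- move=> n0; have := congr1 (map_mx f) (r1 n0); rewrite map_mx0 => E.
  rewrite -[RHS]E (big_morph (map_mx f) mapM (map_mx1 f _)); apply: eq_bigr => c _.
  by rewrite map_mxB map_scalar_mx.
- move=> i /r2 /(congr1 (map_mx f)); rewrite mapM map_mx0.
  by rewrite map_mxB map_mxD map_scalar_mx map_mx1.
- by move=> /r3 /(congr1 (map_mx f)); rewrite !expr2 !mapM.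
- by move=> i i1 i2; have /(congr1 (map_mx f)) := r4 i i1 i2; rewrite !mapM.
- by move=> i j ij; have /(congr1 (map_mx f)) := r5 i j ij; rewrite !mapM.
Qed.

(** * One dimensional composition factors *)

(** If X is a column u times a row v, then X Y X = (v Y u) X and v Y u is the trace of X Y. The
    vanishing of the minors replaces this factorization, which need not exist over a ring. *)
Lemma minors_sandwich (F : comNzRingType) d (X Y : 'M[F]_d) :
  (forall i j i' j', X i j * X i' j' = X i j' * X i' j) ->
  X *m Y *m X = \tr (X *m Y) *: X.
Proof.
move=> minors; apply/matrixP => i j; rewrite mxE [RHS]mxE mulrC.
rewrite /mxtrace mulr_sumr.
under eq_bigr => k _ do rewrite mxE mulr_suml.
under [RHS]eq_bigr => k _ do rewrite mxE mulr_sumr.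
apply: eq_bigr => k _; apply: eq_bigr => k' _.
by rewrite mulrAC mulrA minors.
Qed.

(** A tableau that lives in first rows is encoded by the word of its components: the column of an
    entry counts the earlier occurrences of its letter. *)
Definition wtab (l n : nat) (w : nat -> 'I_l) : {ffun 'I_n -> node l} :=
  [ffun i : 'I_n => (0%N, count_mem (w i) (mkseq w i), w i)].

Section Lattice.
Variables (A : comNzRingType) (K C : fieldType).
Variables (inc : {rmorphism A -> K}) (th : {rmorphism A -> C}).
Variables (l n : nat) (q qi : A) (Q : 'I_l -> A) (V : mxmod A) (la : mpart l).

(** The eigenvalue of a Jucys-Murphy element, written with an inverse [qi] of q so as to lie in [A];
    [jcont] is the eigenvalue of the unnormalized q^i L_(i+1). *)
Definition cont (x : node l) : A := Q x.2 * q ^+ x.1.2 * qi ^+ x.1.1.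
Definition jcont (i : nat) (x : node l) : A := q ^+ i * cont x.

Local Notation tableau := {ffun 'I_n -> node l}.
Local Notation W := (map_mxmod inc V).

(** The factor of [t] kills the weight vector of [t]. The index [j t] is left free, to be chosen so
    that this factor does not vanish on a given other weight. *)
Definition tpoly (j : tableau -> 'I_n) (s : seq tableau) : seq (seq nat * A) :=
  [seq (jword (j t), jcont (j t) (t (j t))) | t <- s].

Lemma pwords_tpoly j s : pwords n (tpoly j s).
Proof. by rewrite /pwords all_map; apply/allP => t _ /=; exact: jword_lt. Qed.

Hypothesis n_gt0 : (0 < n)%N.
Hypothesis qqi : q * qi = 1.
Hypothesis inc_inj : injective inc.

Section Basis.
Variables (ts : (rdim V).-tuple tableau) (P : 'M[K]_(rdim V)).
Hypothesis uts : uniq ts.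
Hypothesis tsP : forall t, t \in ts <-> standard la t.
Hypothesis unitP : P \in unitmx.
Hypothesis Pjm : forall (r : 'I_(rdim V)) (i : 'I_n),
  row r P *m ev W (jword i) = inc (jcont i (tnth ts r i)) *: row r P.

Lemma row_tpoly j s r : row r P *m pev W (pmap_coef inc (tpoly j s)) =
  inc (\prod_(t <- s) (jcont (j t) (tnth ts r (j t)) - jcont (j t) (t (j t)))) *:
    row r P.
Proof.
elim: s => [|t s IH] /=; first by rewrite mulmx1 big_nil rmorph1 scale1r.
rewrite mulmxA mulmxBr Pjm mul_mx_scalar -scalerBl -scalemxAl IH scalerA.
by rewrite big_cons rmorphM rmorphB.
Qed.

Lemma tpoly_all_eq0 j : pev V (tpoly j ts) = 0.
Proof.
suff : map_mx inc (pev V (tpoly j ts)) = 0.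
  move=> E; apply/matrixP => r r'; apply: inc_inj.
  by have := congr1 (fun X : 'M_(_) => X r r') E; rewrite !mxE rmorph0.
rewrite map_pev.
apply: (can_inj (mulKmx unitP)); rewrite mulmx0.
apply/row_matrixP => r; rewrite row_mul row_tpoly row0.
rewrite (big_rem (tnth ts r) (mem_tnth _ _)) /= subrr mul0r rmorph0.
by rewrite scale0r.
Qed.

Variables (chi : nat -> C).

(** If every standard tableau differed from the weight of [M] at some index, the product of the
    corresponding factors would kill [V] and yet act on [M] by a nonzero scalar. *)
Lemma occurrence (M : mxmod C) : rdim M = 1%N ->
  (forall i, (i < n)%N -> M i = (chi i)%:M) ->
  comp_mult n (map_mxmod th V) M <> 0%N ->
  exists2 t, standard la t & forall i : 'I_n, th (jcont i (t i)) = chiw chi (jword i).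
Proof.
move=> dimM actM mult; apply: contrapT => none.
have sep t : exists j : 'I_n, t \in ts -> th (jcont j (t j)) != chiw chi (jword j).
  have [tin|_] := boolP (t \in ts); last by exists (Ordinal n_gt0).
  apply: contrapT => all_eq; apply: none; exists t; first exact/tsP.
  move=> i; apply: contrapT => ne; apply: all_eq; exists i => _; exact/eqP.
have [j jP] := choice sep.
have : pchi chi (pmap_coef th (tpoly j ts)) = 0.
  apply: comp_mult_neq0 mult _ _ => //; first by rewrite pwords_map pwords_tpoly.
  by rewrite -map_pev tpoly_all_eq0 map_mx0.
move/eqP; rewrite /pchi big_map big_map prodf_seq_eq0 => /hasP[t tin] /=.
by rewrite subr_eq0 eq_sym; apply/negP/jP.
Qed.


(** * A weight space that is a line *)

Section MultiplicityOne.
Variables (w0 : nat -> 'I_l) (rho : 'I_l -> nat).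
Hypothesis generic : forall c c' x x', Q c * q ^+ x = Q c' * q ^+ x' ->
  c = c' /\ x = x'.
Hypothesis relV : AK_relations n q Q V.
Hypothesis simW : simple_mxmod n W.
Hypothesis onerow : forall a b c, in_diagram la (a, b, c) -> a = 0%N.
Hypothesis wtab_std : forall w, rearrangement n w0 w -> standard la (wtab n w).
Hypothesis w0_sorted :
  forall j, (0 < j < n)%N -> (rho (w0 j.-1) <= rho (w0 j))%N.
Hypothesis rho_inj : forall i i', (i < n)%N -> (i' < n)%N ->
  rho (w0 i) = rho (w0 i') -> w0 i = w0 i'.

Local Notation t0 := (wtab n w0).

Hypothesis t0_unique : forall t, standard la t ->
  (forall i : 'I_n, th (jcont i (t i)) = th (jcont i (t0 i))) -> t = t0.
Hypothesis chi_q : forall j, (1 <= j < n)%N -> chi j = th q.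
Hypothesis chi_jword : forall i : 'I_n, chiw chi (jword i) = th (jcont i (t0 i)).

Let relW := AK_relations_map inc relV.

Variable r0 : 'I_(rdim V).
Hypothesis r0P : tnth ts r0 = t0.

Local Notation b := (row r0 P).
Local Notation J i := (ev W (jword i)).

Lemma row_expand (z : 'rV[K]_(rdim V)) :
  z = \sum_r (z *m invmx P) 0 r *: row r P.
Proof. by rewrite -mulmx_sum_row mulmxKV. Qed.

(** A nonzero coordinate of a weight vector in the basis [P] forces its weight to be that of the
    corresponding tableau. *)
Lemma weight_tableau (z : 'rV[K]_(rdim V)) (x : 'I_n -> A) : z != 0 ->
  (forall i : 'I_n, z *m J i = inc (x i) *: z) ->
  exists2 t, standard la t & forall i : 'I_n, jcont i (t i) = x i.
Proof.
move=> z0 zJ; have [r yr] : exists r, (z *m invmx P) 0 r != 0.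
  apply: contrapT => none; case/eqP: z0; rewrite (row_expand z).
  apply: big1 => r _; have [->|nz] := eqVneq ((z *m invmx P) 0 r) 0.
    by rewrite scale0r.
  by case: none; exists r.
exists (tnth ts r); first by apply/tsP/mem_tnth.
move=> i; apply: inc_inj; apply: (mulfI yr).
have : z *m J i *m invmx P = inc (x i) *: (z *m invmx P).
  by rewrite zJ -scalemxAl.
rewrite {1}(row_expand z) mulmx_suml.
under eq_bigr => r' _ do rewrite -scalemxAl Pjm.
rewrite mulmx_suml => /matrixP/(_ 0 r); rewrite summxE [RHS]mxE (bigD1 r) //=.
rewrite big1 => [|r' r'r].
  rewrite addr0 -!scalemxAl -row_mul mulmxV // !mxE eqxx mulr1 => ->.
  by rewrite mulrC.
by rewrite -!scalemxAl -row_mul mulmxV // !mxE (negPf r'r) !mulr0.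
Qed.

Lemma q_unit_eq m x y : q ^+ m * x = q ^+ m * y -> x = y.
Proof.
by move=> /(congr1 ( *%R (qi ^+ m))); rewrite !mulrA -exprMn [qi * q]mulrC qqi expr1n !mul1r.
Qed.

Lemma q_inc_neq0 : inc q != 0.
Proof.
apply/eqP => q0; have := congr1 inc qqi; rewrite rmorphM q0 mul0r rmorph1.
by move/esym/eqP; rewrite oner_eq0.
Qed.

(** The defect b T_j - q b, if nonzero, would have the weight of the tableau with two neighbouring
    entries of a row exchanged, which is not standard. *)
Lemma row_eigen j : (0 < j < n)%N -> w0 j.-1 = w0 j ->
  b *m W j = inc q *: b.
Proof.
case: j => // j jn wj; apply/eqP; rewrite -subr_eq0; set z := (_ - _).
rewrite [j.+1.-1]/= in wj.
have lej : (j < n)%N by apply: ltnW; case/andP: jn.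
have ltj : (j.+1 < n)%N by case/andP: jn.
pose x (i : 'I_n) := jcont i (wtab n w0 i); pose i1 := Ordinal lej; pose i2 := Ordinal ltj.
have bJ (i : 'I_n) : b *m J i = inc (x i) *: b by rewrite Pjm r0P.
pose cnt i := count_mem (w0 i) (mkseq w0 i).
have xE (i : 'I_n) : x i = q ^+ i * (Q (w0 i) * q ^+ cnt i).
  by rewrite /x /jcont ffunE /cont /= mulr1.
have cw : cnt j.+1 = (cnt j).+1.
  rewrite /cnt -wj /mkseq -(addn1 j) iotaD map_cat count_cat /= add0n eqxx.
  by rewrite addn0 addn1.
have x12 : x i2 = q ^+ 2 * x i1.
  by rewrite !xE [nat_of_ord i1]/= [nat_of_ord i2]/= cw -wj !exprS expr0; ring.
pose Wj : 'M_(rdim V) := (map_mxmod inc V) j.+1; have b1 := bJ i1; have b2 := bJ i2.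
apply: contrapT => /negP z0.
(* The two contents are exchanged; because of the powers of q in [jcont], both eigenvalues become
   [q * x i1]. *)
have zJ (i : 'I_n) : z *m J i = inc (if (i == i1) || (i == i2) then q * x i1 else x i) *: z.
  have [->|ne1] /= := eqVneq i i1; last have [->|ne2] /= := eqVneq i i2.
  - apply: (scalerI q_inc_neq0); rewrite scalemxAr mulmxBl.
    have -> : (inc q *: b) *m (inc q *: J i1) = (inc q * inc q * inc (x i1)) *: b.
      by rewrite -scalemxAl -scalemxAr b1 !scalerA.
    have -> : b *m Wj *m (inc q *: J i1) = inc (x i2) *: (b *m Wj)
        - ((inc q - 1) * inc (x i2)) *: b.
      rewrite -mulmxA -scalemxAr (T_jm_pred relW ltj) mulmxBr mulmxA b2.
      by rewrite -scalemxAl -scalemxAr b2 scalerA.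
    rewrite /z -/Wj x12 !rmorphM !rmorphXn; move: (b *m Wj) => u.
    by apply/matrixP => ? ?; rewrite !mxE; ring.
  - rewrite mulmxBl -!scalemxAl b2.
    have -> : b *m Wj *m J i2 = ((inc q - 1) * inc (x i2)) *: b
        + (inc q * inc (x i1)) *: (b *m Wj).
      rewrite -mulmxA (T_jm relW ltj) mulmxDr -!scalemxAr mulmxA b1 b2.
      by rewrite -scalemxAl !scalerA.
    rewrite /z -/Wj x12 !rmorphM !rmorphXn; move: (b *m Wj) => u.
    by apply/matrixP => ? ?; rewrite !mxE; ring.
  - have ij : val i != j.+1 by apply/eqP => e; case/eqP: ne2; apply/val_inj.
    have ij' : (val i).+1 != j.+1 by apply/eqP => -[e]; case/eqP: ne1; apply/val_inj.
    rewrite /z mulmxBl -!scalemxAl -mulmxA (jm_comm relW jn (ltn_ord i) ij ij').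
    by rewrite mulmxA bJ -!scalemxAl scalerBr !scalerA [inc q * _]mulrC.
have [t stt tx] := weight_tableau z0 zJ.
have [inj_t dia_t mono_t] := stt.
have t_row (i : 'I_n) : t i = (0%N, (t i).1.2, (t i).2).
  by case E : (t i) => [[a b'] c] /=; have := dia_t i; rewrite E => /onerow ->.
(* In first rows the generic eigenvalues determine component and column; they put the later entry to
   the left of the earlier one. *)
have := tx i1; rewrite eqxx xE mulrCA => /q_unit_eq.
rewrite t_row /cont /= expr0 mulr1 mulrCA -exprS => /generic[c1 d1].
have := tx i2; rewrite eqxx orbT xE /jcont /= mulrA -exprS => /q_unit_eq.
rewrite [t i2]t_row /cont /= expr0 mulr1 => /generic[c2 d2].
have := mono_t i2 i1; rewrite c1 c2 => /(_ erefl).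
suff : ((t i2).1.1 = (t i1).1.1 /\ ((t i2).1.2 < (t i1).1.2)%N) by move=> h /(_ (or_introl h)) /=; lia.
by rewrite d1 d2 (t_row i1) (t_row i2).
Qed.

(** One recursion produces both T_w b and the value of the linear form on it, the specialization of
    q^l(w). *)
Let evec : (nat -> 'I_l) -> 'rV[K]_(rdim V) :=
  word_vec rho n (fun j x => x *m W j) b.
Let eaug : (nat -> 'I_l) -> C := word_vec rho n (fun _ z => th q * z) 1.

Lemma evec_spec w : rearrangement n w0 w -> forall j, (0 < j < n)%N ->
  (descent rho j w -> evec w = evec (wswap j w) *m W j) /\
  (w j.-1 = w j -> evec w *m W j = inc q *: evec w).
Proof.
apply: (@word_vec_spec _ rho n w0 w0_sorted rho_inj _ (fun j x => x *m W j)
  (fun x => inc q *: x) b) => //.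
- by move=> j x _; rewrite -scalemxAl.
- move=> j x j0 jn; rewrite -!mulmxA; congr (x *m _); rewrite !mulmxA.
  exact: (braid relW).
- by move=> i j x i0 ij; rewrite -!mulmxA (far_comm relW ij).
- by move=> j jn /(row_eigen jn).
Qed.

Lemma eaug_spec w : rearrangement n w0 w -> forall j, (0 < j < n)%N ->
  descent rho j w -> eaug w = th q * eaug (wswap j w).
Proof.
move=> rw j jn; apply: (proj1 (@word_vec_spec _ rho n w0 w0_sorted rho_inj _
  (fun _ z => th q * z) (fun z => th q * z) 1 (fun _ _ _ => erefl)
  (fun _ _ _ _ => erefl) (fun _ _ _ _ _ => erefl) (fun _ _ _ => erefl)
  w rw j jn)).
Qed.

Definition extw (f : {ffun 'I_n -> 'I_l}) : nat -> 'I_l :=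
  fun i => if insub i is Some k then f k else w0 i.

Definition goodw (f : {ffun 'I_n -> 'I_l}) : bool :=
  perm_eq (mkseq (extw f) n) (mkseq w0 n).

Lemma extw_rearrangement f : goodw f -> rearrangement n w0 (extw f).
Proof.
by move=> gf; split=> // i ni; rewrite /extw insubF //; apply/negbTE; rewrite -leqNgt.
Qed.

Lemma extwK w : rearrangement n w0 w ->
  extw [ffun i : 'I_n => w i] = w /\ goodw [ffun i : 'I_n => w i].
Proof.
move=> [wn wp]; suff E : extw [ffun i : 'I_n => w i] = w by rewrite /goodw E.
apply/funext => i; rewrite /extw; case: insubP => [k _ <-|]; first by rewrite ffunE.
by rewrite -leqNgt => /wn.
Qed.

(* The [evec w] span an A-lattice, and [augmented x z] says that [x] belongs to
   this lattice and that [z] is its image under the linear form that sends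
   [evec w] to [eaug w]; this form is equivariant up to [chi]. *)
Definition augmented (x : 'rV[K]_(rdim V)) (z : C) : Prop :=
  exists a : {ffun 'I_n -> 'I_l} -> A,
    x = \sum_(f | goodw f) inc (a f) *: evec (extw f) /\
    z = \sum_(f | goodw f) th (a f) * eaug (extw f).

Lemma augmented0 : augmented 0 0.
Proof.
exists (fun=> 0); split; rewrite big1 // => f _.
  by rewrite rmorph0 scale0r.
by rewrite rmorph0 mul0r.
Qed.

Lemma augmentedD c x y z t : augmented x z -> augmented y t ->
  augmented (inc c *: x + y) (th c * z + t).
Proof.
move=> [a [-> ->]] [a' [-> ->]]; exists (fun f => c * a f + a' f); split.
  rewrite scaler_sumr -big_split /=; apply: eq_bigr => f _.
  by rewrite rmorphD rmorphM scalerDl scalerA.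
rewrite mulr_sumr -big_split /=; apply: eq_bigr => f _.
by rewrite rmorphD rmorphM mulrDl mulrA.
Qed.

Lemma augmentedZ c x z : augmented x z -> augmented (inc c *: x) (th c * z).
Proof. by move=> /(augmentedD c)/(_ augmented0); rewrite !addr0. Qed.

Lemma augmented_evec w : rearrangement n w0 w -> augmented (evec w) (eaug w).
Proof.
move=> /extwK[E good]; exists (fun f => (f == [ffun i : 'I_n => w i])%:R); split.
  rewrite (bigD1 [ffun i : 'I_n => w i]) //= E eqxx rmorph1 scale1r big1 ?addr0 //.
  by move=> f /andP[_ /negPf ->]; rewrite rmorph0 scale0r.
rewrite (bigD1 [ffun i : 'I_n => w i]) //= E eqxx rmorph1 mul1r big1 ?addr0 //.
by move=> f /andP[_ /negPf ->]; rewrite rmorph0 mul0r.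
Qed.

Lemma augmented_lin (Y : 'M[K]_(rdim V)) c :
  (forall w, rearrangement n w0 w -> augmented (evec w *m Y) (c * eaug w)) ->
  forall x z, augmented x z -> augmented (x *m Y) (c * z).
Proof.
move=> YP _ _ [a [-> ->]]; rewrite mulmx_suml mulr_sumr.
elim/big_rec2: _ => [|f x z gf IH]; first exact: augmented0.
rewrite -scalemxAl mulrCA; apply: augmentedD => //.
exact/YP/extw_rearrangement.
Qed.

Lemma eq_augmented x z x' z' : x = x' -> z = z' -> augmented x z -> augmented x' z'.
Proof. by move=> -> ->. Qed.

(** With s the swap, T_j sends e_w to (q - 1) e_w + q e_(sw) at a descent, to e_(sw) at an ascent,
    and to q e_w at equal letters. In each case the value of the form is multiplied by q. *)
Lemma augmented_T j : (0 < j < n)%N ->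
  forall x z, augmented x z -> augmented (x *m W j) (th q * z).
Proof.
move=> jn; apply: augmented_lin => w rw.
have rs := rearrangement_swap jn rw.
have w_swap : wswap j (wswap j w) = w.
  apply/funext => k; rewrite /wswap; have : (j.-1 == j) = false by apply/eqP; lia.
  by move=> jj; repeat (case: eqP => ?; try lia); subst; rewrite ?eqxx ?jj.
have [lt|gt|eq_rho] := ltngtP (rho (w j)) (rho (w j.-1)).
- have [/(_ lt) E _] := evec_spec rw jn; have E' := eaug_spec rw jn lt.
  apply: eq_augmented (augmentedD (q - 1) (augmented_evec rw)
    (augmentedZ q (augmented_evec rs))).
    rewrite {2}E -mulmxA (quad relW) // mulmxDr -scalemxAr -E mul_mx_scalar.
    by rewrite rmorphB rmorph1.
  by rewrite E' rmorphB rmorph1; ring.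
- have desc : descent rho j (wswap j w).
    by rewrite /descent wswap_l wswap_r //; case/andP: jn.
  have [/(_ desc) E _] := evec_spec rs jn; have E' := eaug_spec rs jn desc.
  apply: eq_augmented (augmented_evec rs); first by rewrite E w_swap.
  by rewrite E' w_swap.
- have wj : w j.-1 = w j.
    by symmetry; apply: (rearrangement_rho_inj rho_inj rw) eq_rho; lia.
  have [_ /(_ wj) E] := evec_spec rw jn.
  by rewrite E; exact/augmentedZ/augmented_evec.
Qed.

Lemma chiw_jwordS i : (i.+1 < n)%N ->
  chiw chi (jword i.+1) = th q * chiw chi (jword i) * th q.
Proof.
move=> lti; rewrite jwordS /chiw big_cons big_rcons /= chi_q //.
by rewrite [_ * th q]mulrC; ring.
Qed.

(** T_0 cannot be treated alone: moving a Jucys-Murphy element past T_j produces its neighbour. So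
    all of them are treated at once, by induction from [w0], where they act by scalars. *)
Lemma augmented_J w : rearrangement n w0 w -> forall i, (i < n)%N ->
  augmented (evec w *m J i) (chiw chi (jword i) * eaug w).
Proof.
move: w; apply: (@rearrangement_ind _ rho n w0 w0_sorted rho_inj).
  move=> i lti; have eb : evec w0 = b by exact: word_vec0.
  have e1 : eaug w0 = 1 by exact: word_vec0.
  have rw0 := rearrangement_refl n w0.
  rewrite (chi_jword (Ordinal lti)) {1}eb.
  apply: eq_augmented (augmentedZ (jcont i (t0 (Ordinal lti))) (augmented_evec rw0)) => //.
  by rewrite eb -r0P; symmetry; exact: (Pjm r0 (Ordinal lti)).
move=> w j rw jn desc IH i lti; have rs := rearrangement_swap jn rw.
have [/(_ desc) -> _] := evec_spec rw jn; rewrite (eaug_spec rw jn desc).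
rewrite -mulmxA; have [ij|ij] := eqVneq i j.
  subst i; case: j jn desc IH lti rs => // j jn desc IH lti rs.
  rewrite (T_jm relW) // mulmxDr -!scalemxAr mulmxA.
  apply: eq_augmented (augmentedD (q - 1) (IH _ lti)
    (augmentedZ q (augmented_T jn (IH _ (ltnW lti)))));
    first by rewrite rmorphB rmorph1.
  by rewrite rmorphB rmorph1 chiw_jwordS //; ring.
have [ij'|ij'] := eqVneq i.+1 j.
  subst j; have qiq : inc qi * inc q = 1 by rewrite -rmorphM mulrC qqi rmorph1.
  have thqiq : th qi * th q = 1 by rewrite -rmorphM mulrC qqi rmorph1.
  have lti1 : (i.+1 < n)%N by case/andP: jn.
  have -> : W i.+1 *m J i =
      inc qi *: (J i.+1 *m W i.+1 - (inc q - 1) *: J i.+1).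
    by rewrite -(T_jm_pred relW lti1) scalerA qiq scale1r.
  rewrite -scalemxAr mulmxBr mulmxA -scalemxAr.
  apply: eq_augmented (augmentedZ qi (augmentedD (1 - q) (IH _ lti1)
    (augmented_T jn (IH _ lti1)))).
    by rewrite addrC rmorphB rmorph1 -opprB scaleNr.
  rewrite rmorphB rmorph1 chiw_jwordS //.
  transitivity ((th qi * th q) * (chiw chi (jword i) * th q * eaug (wswap i.+1 w))); first by ring.
  by rewrite thqiq; ring.
rewrite (jm_comm relW jn lti ij ij') mulmxA.
apply: eq_augmented (augmented_T jn (IH _ lti)) => //; ring.
Qed.

Lemma augmented_act i : (i < n)%N ->
  forall x z, augmented x z -> augmented (x *m W i) (chi i * z).
Proof.
case: i => [|i] lti x z; last by rewrite chi_q //; exact: augmented_T.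
apply: augmented_lin => w rw; have := augmented_J rw lti.
by rewrite /= mulmx1 /chiw big_seq1.
Qed.

Lemma augmented_ev h : all (ltn^~ n) h ->
  forall x z, augmented x z -> augmented (x *m ev W h) (chiw chi h * z).
Proof.
elim: h => [_ x z|i h IH /= /andP[lti lth] x z xz].
  by rewrite /= mulmx1 /chiw big_nil mul1r.
rewrite mulmxA /chiw big_cons [chi i * _]mulrC -mulrA.
exact/IH/augmented_act.
Qed.

Lemma augmented_pev p : pwords n p -> forall x z, augmented x z ->
  augmented (x *m pev W (pmap_coef inc p)) (pchi chi (pmap_coef th p) * z).
Proof.
elim: p => [_ x z|[h c] p IH /= /andP[lth ltp] x z xz].
  by rewrite /= mulmx1 /pchi big_nil mul1r.
rewrite mulmxA /pchi big_cons /= [(_ - _) * _]mulrC -mulrA.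
apply: IH => //; rewrite mulmxBr mul_mx_scalar mulrBl.
apply: eq_augmented (augmentedD (- c) xz (augmented_ev lth xz)).
  by rewrite rmorphN scaleNr addrC.
by rewrite rmorphN mulNr addrC.
Qed.

Lemma wtab_inj w w' : rearrangement n w0 w -> rearrangement n w0 w' ->
  wtab n w = wtab n w' -> w = w'.
Proof.
move=> [wn _] [wn' _] /ffunP E; apply/funext => i.
have [lti|ge] := ltnP i n; last by rewrite wn ?wn'.
by have := E (Ordinal lti); rewrite !ffunE => -[].
Qed.

(** The span is stable and nonzero, hence everything by simplicity over [K]. Distinct words give
    distinct standard tableaux, so the number of vectors is at most the dimension, and a spanning
    family of this size is free. *)
Lemma evec_free (a : {ffun 'I_n -> 'I_l} -> K) :
  \sum_(f | goodw f) a f *: evec (extw f) = 0 ->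
  forall f, goodw f -> a f = 0.
Proof.
pose N := #|[pred f | goodw f]|.
pose E : 'M[K]_(N, rdim V) := \matrix_(i < N) evec (extw (enum_val i)).
have E_in w : rearrangement n w0 w -> (evec w <= E)%MS.
  move=> /extwK[wE good].
  have : [ffun i : 'I_n => w i] \in [pred f | goodw f] by [].
  move=> in_f; have := row_sub (enum_rank_in in_f [ffun i : 'I_n => w i]) E.
  by rewrite rowK enum_rankK_in // wE.
have augE x z : augmented x z -> (x <= E)%MS.
  move=> [c [-> _]]; apply: summx_sub => f /extw_rearrangement/E_in.
  exact: scalemx_sub.
have leN : (N <= rdim V)%N.
  rewrite -(size_tuple ts) /N cardE -(size_map (fun f => wtab n (extw f))).
  apply: uniq_leq_size.
    rewrite map_inj_in_uniq ?enum_uniq // => f f'; rewrite !mem_enum => gf gf'.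
    move=> /(wtab_inj (extw_rearrangement gf) (extw_rearrangement gf')) /(congr1 (fun w : nat -> _ => w)) E'.
    apply/ffunP => i; have := congr1 (fun w : nat -> _ => w i) E'.
    by rewrite /extw valK.
  move=> t /mapP[f]; rewrite mem_enum => gf ->.
  exact/tsP/wtab_std/extw_rearrangement.
have full : row_full E.
  have [d0 simple] := simW.
  have subE : submodule n (V := W) <<E>>%MS.
    move=> i lti; rewrite (eqmxMr _ (genmxE E)) genmxE; apply/row_subP => r.
    rewrite row_mul rowK; have gr : goodw (enum_val r) by exact: (enum_valP r).
    exact/augE/augmented_act/augmented_evec/extw_rearrangement.
  case: (simple _ subE).
  - move=> E0.
    have : (evec w0 <= <<E>>)%MS by rewrite genmxE; exact/E_in/rearrangement_refl.
    have {}E0 : <<E>>%MS = 0 :> 'M_(rdim V) by exact: E0.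
    rewrite E0 submx0 => /eqP.
    have -> : evec w0 = b by exact: word_vec0.
    move=> b0; have /row_freeP[P' PP'] : row_free P by rewrite row_free_unit.
    have := congr1 (row r0) PP'; rewrite row_mul b0 mul0mx => /rowP/(_ r0).
    by rewrite !mxE eqxx => /esym/eqP; rewrite oner_eq0.
  - by rewrite /row_full mxrank_gen.
have free : row_free E.
  rewrite /row_free eqn_leq rank_leq_row /=.
  by move: full; rewrite /row_full => /eqP ->.
move=> sum0 f gf.
pose y := \row_(i < N) a (enum_val i).
have : y *m E = 0.
  rewrite mulmx_sum_row -[RHS]sum0.
  rewrite [RHS](eq_bigl (mem [pred f | goodw f])) // [RHS]big_enum_val /=.
  by apply: eq_bigr => i _; rewrite mxE rowK.
move=> yE; have y0 : y = 0 by apply: (row_free_inj free); rewrite yE mul0mx.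
have gf' : f \in [pred f | goodw f] by [].
by have := congr1 (fun y : 'rV_N => y 0 (enum_rank_in gf' f)) y0; rewrite !mxE enum_rankK_in.
Qed.

(** Freeness makes the linear form well defined on the lattice. *)
Lemma augmented_inj x z z' : augmented x z -> augmented x z' -> z = z'.
Proof.
move=> [a [-> ->]] [a' [E ->]]; apply: eq_bigr => f gf; congr (th _ * _).
apply/inc_inj/eqP; rewrite -subr_eq0; apply/eqP.
apply: (evec_free (a := fun f => inc (a f) - inc (a' f))) gf.
under eq_bigr => f' _ do rewrite scalerBl.
by rewrite sumrB E subrr.
Qed.

(** [X] is a product of factors that kill all weights but that of [t0], and each is nonzero on this
    weight after specialization. Over [K] it maps onto the line of [b], so X h X = a_h X. The form,
    evaluated in two ways on b X h X, yields the specialization of a_h, although [V] need not be the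
    lattice of the [evec]. *)
Lemma multiplicity_one (M : mxmod C) : rdim M = 1%N ->
  (forall i, (i < n)%N -> M i = (chi i)%:M) ->
  comp_mult n (map_mxmod th V) M = 1%N.
Proof.
move=> dimM actM; pose s := [seq t <- ts | t != t0].
have sep t : exists j : 'I_n,
    t \in s -> th (jcont j (t0 j)) - th (jcont j (t j)) != 0.
  have [tin|_] := boolP (t \in s); last by exists (Ordinal n_gt0).
  move: tin; rewrite mem_filter => /andP[/eqP tt0 tin].
  apply: contrapT => all_eq; apply: tt0; apply: t0_unique; first exact/tsP.
  move=> i; apply: contrapT => ne; apply: all_eq; exists i => _.
  by rewrite subr_eq0 eq_sym; apply/eqP.
have [j jP] := choice sep; pose p := tpoly j s; pose X := pev V p.
have ltp : pwords n p by exact: pwords_tpoly.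
pose f0 : A := \prod_(t <- s) (jcont (j t) (t0 (j t)) - jcont (j t) (t (j t))).
pose c := pchi chi (pmap_coef th p).
have cE : c = th f0.
  rewrite /c /pchi big_map big_map rmorph_prod; apply: eq_bigr => t _ /=.
  by rewrite chi_jword rmorphB.
have c0 : c != 0.
  rewrite cE rmorph_prod prodf_seq_neq0; apply/allP => t tin /=.
  by rewrite rmorphB; exact: jP.
pose XK := pev W (pmap_coef inc p).
have XKE : XK = map_mx inc X by rewrite map_pev.
have rowXK r : row r P *m XK = if r == r0 then inc f0 *: b else 0.
  rewrite row_tpoly; have [->|ne] := eqVneq r r0; first by rewrite r0P.
  rewrite (big_rem (tnth ts r)) /=; first by rewrite subrr mul0r rmorph0 scale0r.
  rewrite mem_filter mem_tnth andbT -r0P; apply: contra ne => /eqP E.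
  apply/eqP/val_inj; have [lt lt0] : (r < size ts)%N /\ (r0 < size ts)%N by rewrite size_tuple !ltn_ord.
  by apply/eqP; rewrite -(nth_uniq (tnth ts r) lt lt0 uts) -!tnth_nth E.
(* Over [K], [X] is a column of the inverse of [P] times a multiple of a row of [P], so its minors
   vanish already in [A]. *)
have minors i k i' k' : X i k * X i' k' = X i k' * X i' k.
  have XKij i1 k1 : inc (X i1 k1) = invmx P i1 r0 * (inc f0 * P r0 k1).
    have : XK = invmx P *m (P *m XK) by rewrite mulKmx.
    rewrite XKE => /matrixP/(_ i1 k1); rewrite mxE => ->; rewrite mxE (bigD1 r0) //=.
    have rowE r : (P *m map_mx inc X) r k1 = (row r P *m XK) 0 k1.
      by rewrite -row_mul XKE [RHS]mxE.
    rewrite big1 => [|r ne]; rewrite rowE rowXK.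
      by rewrite eqxx addr0 !mxE.
    by rewrite (negPf ne) mxE mulr0.
  by apply: inc_inj; rewrite !rmorphM !XKij; ring.
have XhX h : X *m ev V h *m X = \tr (X *m ev V h) *: X by exact: minors_sandwich.
have aug1 : augmented b 1.
  apply: eq_augmented (augmented_evec (rearrangement_refl n w0)); exact: word_vec0.
have th_tr h : all (ltn^~ n) h -> th (\tr (X *m ev V h)) = c * chiw chi h.
  move=> lth; set a := \tr _.
  have augX := augmented_pev ltp aug1.
  have augXhX := augmented_pev ltp (augmented_ev lth augX).
  (* The form takes the value c chi(h) c on the left and th(a) c on the right, and c can be
     cancelled. *)
  have E : b *m XK *m ev W h *m XK = inc a *: (b *m XK).
    have := congr1 (map_mx inc) (XhX h); rewrite map_mxM map_mxM -XKE map_ev map_mxZ -XKE => E.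
    by rewrite scalemxAr -E !mulmxA.
  have := augmented_inj (eq_augmented E erefl augXhX) (augmentedZ a augX).
  rewrite -/c mulr1 => /eqP; rewrite mulrA; rewrite (inj_eq (mulIf c0)).
  by move=> /eqP <-.
apply: (comp_mult_one dimM actM (p := pmap_coef th p)) => //.
- by rewrite pwords_map.
- by move=> i k i' k'; rewrite -map_pev !mxE -!rmorphM minors.
- apply: contra_neq c0 => X0; have := th_tr [::] isT.
  rewrite /= mulmx1 /chiw big_nil mulr1 => <-.
  by rewrite -trace_map_mx map_pev X0 raddf0.
- move=> h lth; rewrite -map_pev -map_ev -!map_mxM XhX map_mxZ.
  by rewrite th_tr.
Qed.

End MultiplicityOne.
End Basis.
End Lattice.

(** * Standard tableaux *)

Section Rows.
Local Open Scope nat_scope.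
Variables (l : nat).

Definition wcount (w : nat -> 'I_l) (n : nat) (c : 'I_l) : nat :=
  count_mem c (mkseq w n).

Definition rows (n : nat) (w : nat -> 'I_l) : mpart l :=
  [ffun c => nseq (0 < wcount w n c) (wcount w n c)].

Lemma wcountS w n c : wcount w n.+1 c = wcount w n c + (w n == c).
Proof. by rewrite /wcount /mkseq -(addn1 n) iotaD map_cat count_cat /= addn0. Qed.

Lemma wcount_const a i c : wcount (fun=> a) i c = if c == a then i else 0.
Proof.
elim: i => [|i IH]; first by rewrite if_same.
by rewrite wcountS IH eq_sym; case: eqP; rewrite ?addn1.
Qed.

Lemma wcount_mono w i j c : i <= j -> wcount w i c <= wcount w j c.
Proof.
move=> /subnKC <-; elim: (j - i) => [|d IH]; first by rewrite addn0.
by rewrite addnS wcountS; lia.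
Qed.

Lemma wcount_lt w i j : i < j -> wcount w i (w i) < wcount w j (w i).
Proof.
by move=> /(wcount_mono w (w i)); rewrite wcountS eqxx addn1.
Qed.

Lemma part_rows n w c a :
  part (rows n w) c a = if a == 0 then wcount w n c else 0.
Proof.
rewrite /part ffunE; case: (wcount w n c) => [|m] /=; first by rewrite nth_nil if_same.
by case: a => //= a; rewrite nth_nil.
Qed.

Lemma rows_mpart n w : is_mpart n (rows n w).
Proof.
split=> [c|].
  by rewrite ffunE; case: (wcount w n c) => [|m] /=; rewrite ?inE.
have -> : \sum_(c < l) sumn (rows n w c) = \sum_(c < l) wcount w n c.
  by apply: eq_bigr => c _; rewrite ffunE; case: (wcount w n c) => //= m; rewrite addn0.
elim: n => [|n IH]; first by rewrite big1.
under eq_bigr do rewrite wcountS.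
rewrite big_split /= IH (bigD1 (w n)) //= eqxx big1 ?addn1 // => c /negPf cn.
by rewrite eq_sym cn.
Qed.

Lemma rows_onerow n w a b c : in_diagram (rows n w) (a, b, c) -> a = 0.
Proof. by rewrite /in_diagram part_rows /=; case: a. Qed.

Lemma wtabE n w (i : 'I_n) : wtab n w i = (0, wcount w i (w i), w i).
Proof. by rewrite ffunE. Qed.

Lemma wtab_standard n w0 w : rearrangement n w0 w ->
  standard (rows n w0) (wtab n w).
Proof.
move=> [_ wp]; split=> [i j|i|i j].
- rewrite !wtabE => -[E wij]; apply/val_inj.
  have [lt|gt|//] := ltngtP (i : nat) j.
    by have := wcount_lt w lt; rewrite E wij ltnn.
  by have := wcount_lt w gt; rewrite -E -wij ltnn.
- rewrite wtabE /in_diagram part_rows /= /wcount.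
  have /permP <- := wp; exact: (wcount_lt w (ltn_ord i)).
- rewrite !wtabE /= => wij [[_ lt]|[_] //]; rewrite ltnNge; apply/negP => le.
  by have := wcount_mono w (w j) le; rewrite -{2}wij; lia.
Qed.

End Rows.

Section Tableaux.
Variables (l n : nat).

Section Shape.
Variable la : mpart l.
Hypothesis la_part : is_mpart n la.

Lemma part_sorted c a : (part la c a.+1 <= part la c a)%N.
Proof.
have [/(_ c)[so _] _] := la_part; rewrite /part.
have [lt|ge] := ltnP a.+1 (size (la c)); last by rewrite nth_default.
exact: (elimT (sortedP 0%N) so a lt).
Qed.

Lemma size_row c : (size (la c) <= n)%N.
Proof.
have [/(_ c)[_ n0] <-] := la_part; rewrite (bigD1 c) //=.
apply: (@leq_trans (sumn (la c))); last exact: leq_addr.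
elim: (la c) n0 => //= x s IH; rewrite inE negb_or => /andP[x0 /IH]; lia.
Qed.

Lemma part0 c a : (n <= a)%N -> part la c a = 0%N.
Proof. by move=> na; rewrite /part nth_default //; have := size_row c; lia. Qed.

Lemma sum_part T : (n <= T)%N -> (\sum_(c < l) \sum_(a < T) part la c a)%N = n.
Proof.
move=> nT; have [_ <-] := la_part; apply: eq_bigr => c _.
have le := leq_trans (size_row c) nT.
rewrite -(big_mkord xpredT (part la c)) (big_cat_nat (leq0n _) le) /=.
have -> : (\sum_(size (la c) <= a < T) part la c a = 0)%N.
  by rewrite big_nat; apply: big1 => a /andP[sa _]; rewrite /part nth_default.
by rewrite addn0 sumnE [RHS](big_nth 0%N).
Qed.

(** The number [T] of rows is a parameter, so that sums over nodes can be matched with sums over the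
    first [T] rows of each component. *)
Definition dnodes T : seq (node l) :=
  [seq (ab, c) | c <- enum 'I_l,
     ab <- [seq (a, b) | a <- iota 0 T, b <- iota 0 (part la c a)]].

Lemma big_dnodes (M : nmodType) (F : node l -> M) T :
  \sum_(x <- dnodes T) F x =
  \sum_(c < l) \sum_(a < T) \sum_(b < part la c a) F (val a, val b, c).
Proof.
have iotaE m (G : nat -> M) : \sum_(a <- iota 0 m) G a = \sum_(a < m) G a.
  by rewrite -(big_mkord xpredT G) /index_iota subn0.
rewrite big_allpairs_dep /= big_enum /=; apply: eq_bigr => c _.
rewrite big_allpairs_dep /= iotaE; apply: eq_bigr => a _; exact: iotaE.
Qed.

Lemma size_dnodes T : (n <= T)%N -> size (dnodes T) = n.
Proof.
move=> nT; rewrite -[RHS](sum_part nT) -sum1_size.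
rewrite (big_dnodes (M := nat) (fun=> 1%N)); apply: eq_bigr => c _.
by apply: eq_bigr => a _; rewrite sum_nat_const card_ord muln1.
Qed.

Lemma mem_dnodes T x : (n <= T)%N -> (x \in dnodes T) = in_diagram la x.
Proof.
move=> nT; case: x => -[a b] c; rewrite /in_diagram /=.
apply/allpairsPdep/idP => [[c' [_ [_ /allpairsPdep[a' [b' [a1 b1 ->]]]]]]|lt].
  by move: b1; rewrite mem_iota => /andP[_ lt] [-> -> ->].
exists c, (a, b); split=> //; first by rewrite mem_enum.
apply/allpairsPdep; exists a, b; split=> //; rewrite mem_iota //=.
by rewrite ltnNge; apply/negP => Ta; rewrite part0 ?ltn0 // in lt; lia.
Qed.

Variable t : {ffun 'I_n -> node l}.
Hypothesis t_std : standard la t.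

Lemma perm_tableau T : (n <= T)%N -> perm_eq [seq t i | i <- enum 'I_n] (dnodes T).
Proof.
move=> nT; have [inj_t dia_t _] := t_std.
have u : uniq [seq t i | i <- enum 'I_n] by rewrite map_inj_uniq ?enum_uniq.
have sub : {subset [seq t i | i <- enum 'I_n] <= dnodes T}.
  by move=> x /mapP[i _ ->]; rewrite mem_dnodes.
have sz : (size (dnodes T) <= size [seq t i | i <- enum 'I_n])%N.
  by rewrite size_dnodes // size_map size_enum_ord.
apply: uniq_perm => //; first exact: leq_size_uniq u sub sz.
by have [] := uniq_min_size u sub sz.
Qed.

Lemma tableau_surj x : in_diagram la x -> exists i, t i = x.
Proof.
rewrite -(mem_dnodes x (leqnn n)) -(perm_mem (perm_tableau (leqnn n))).
by case/mapP=> i _ ->; exists i.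
Qed.

Lemma tableau_sum (M : nmodType) (F : node l -> M) T : (n <= T)%N ->
  \sum_(i < n) F (t i) =
  \sum_(c < l) \sum_(a < T) \sum_(b < part la c a) F (val a, val b, c).
Proof.
move=> nT; rewrite -big_dnodes -(perm_big _ (perm_tableau nT)) big_map.
by rewrite big_enum.
Qed.

Lemma tableau_left (i : 'I_n) a b c : t i = (a, b.+1, c) ->
  exists2 i' : 'I_n, (i' < i)%N & t i' = (a, b, c).
Proof.
move=> ti; have [_ dia_t mono_t] := t_std.
have := dia_t i; rewrite ti /in_diagram /= => lt.
have [|i' ti'] := @tableau_surj (a, b, c); first by rewrite /in_diagram /=; lia.
by exists i' => //; apply: mono_t; rewrite ti ti' //=; left.
Qed.

Lemma tableau_above (i : 'I_n) a b c : t i = (a.+1, b, c) ->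
  exists2 i' : 'I_n, (i' < i)%N & t i' = (a, b, c).
Proof.
move=> ti; have [_ dia_t mono_t] := t_std.
have := dia_t i; rewrite ti /in_diagram /= => lt.
have [|i' ti'] := @tableau_surj (a, b, c).
  by rewrite /in_diagram /=; have := part_sorted c a; lia.
by exists i' => //; apply: mono_t; rewrite ti ti' //=; right.
Qed.

End Shape.

Lemma eq_mpart la mu (t : {ffun 'I_n -> node l}) :
  is_mpart n la -> is_mpart n mu -> standard la t -> standard mu t -> la = mu.
Proof.
move=> pla pmu sla smu; apply/ffunP => c.
have dia x : in_diagram la x = in_diagram mu x.
  apply/idP/idP => [/(tableau_surj pla sla)|/(tableau_surj pmu smu)] [i <-].
    by have [_] := smu.
  by have [_] := sla.
have partE a : part la c a = part mu c a.
  apply/eqP; rewrite eqn_leq; apply/andP; split; rewrite leqNgt; apply/negP => lt.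
    by have := dia (a, part mu c a, c); rewrite /in_diagram /= lt ltnn.
  by have := dia (a, part la c a, c); rewrite /in_diagram /= lt ltnn.
have le_size (la' mu' : mpart l) : is_mpart n la' ->
    (forall a, part la' c a = part mu' c a) -> (size (la' c) <= size (mu' c))%N.
  move=> [/(_ c)[_ n0] _] E; rewrite leqNgt; apply/negP => lt.
  have := E (size (mu' c)); rewrite /part [RHS]nth_default // => E0.
  by case/negP: n0; rewrite -{1}E0 mem_nth.
apply: (@eq_from_nth _ 0%N) => [|a _]; last exact: partE.
by apply/eqP; rewrite eqn_leq !le_size.
Qed.

End Tableaux.

(** * Positions of nodes and greedy words *)

Section Positions.
Variables (l n e : nat) (s : 'I_l -> int) (v : 'I_l -> rat).

Definition charge (c : 'I_l) : rat := (s c)%:~R - v c.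

(* The value to which the creation of a node raises an entry of kappa. *)
Definition npos (x : node l) : rat := charge x.2 + x.1.2%:R - x.1.1%:R.

Definition nres (x : node l) : int := s x.2 + x.1.2%:Z - x.1.1%:Z.

Definition gpos (w : nat -> 'I_l) (i : nat) : rat :=
  charge (w i) + (wcount w i (w i))%:R.

Lemma npos_wtab w (i : 'I_n) : npos (wtab n w i) = gpos w i.
Proof. by rewrite wtabE /npos /= subr0. Qed.

Variables (k : int) (w : nat -> 'I_l).

(* The last condition compares the node added at step [i] with the first node
   of an arbitrary component. *)
Definition greedy : Prop :=
  [/\ forall i, (i < n)%N -> (e%:Z %| s (w i) + (wcount w i (w i))%:Z - (k + i%:Z))%Z,
      forall i, (i.+1 < n)%N -> gpos w i + 1 <= gpos w i.+1 &
      forall i c, (i < n)%N -> (e%:Z %| s c - (k + i%:Z))%Z -> charge c <= gpos w i].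

Hypothesis w_greedy : greedy.

Lemma gpos_mono i j : (i < j < n)%N -> gpos w i + 1 <= gpos w j.
Proof.
have [_ P2 _] := w_greedy.
case/andP=> lt; rewrite -(subnKC lt); elim: (j - i.+1)%N => [|d IH] ltn.
  by rewrite addn0 in ltn *; exact: P2.
rewrite addnS in ltn *; apply: le_trans (IH (ltnW ltn)) _.
by apply: le_trans (P2 _ ltn); lra.
Qed.

Variables (la : mpart l) (t : {ffun 'I_n -> node l}).
Hypothesis la_part : is_mpart n la.
Hypothesis t_std : standard la t.
Hypothesis t_res : forall i : 'I_n, (e%:Z %| nres (t i) - (k + i%:Z))%Z.

(** By induction on [i]: a first node is covered by the last condition of [greedy]. Any other node
    has a left or upper neighbour, added earlier, whose position is at least its own minus one,
    while the greedy positions grow by at least one per step. *)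
Lemma npos_le_gpos (i : 'I_n) : npos (t i) <= gpos w i.
Proof.
have [_ _ P3] := w_greedy.
have [m] := ubnP i; elim: m i => // m IH i ltm.
case ti : (t i) => [[a [|b]] c].
  case: a ti => [|a] ti.
    rewrite /npos /= addr0 subr0; apply: P3 => //.
    by have := t_res i; rewrite ti /nres /= addr0 subr0.
  have [i' lt ti'] := tableau_above la_part t_std ti.
  have := IH i'; rewrite ti' => /(_ (leq_trans lt ltm)).
  have := @gpos_mono i' i; rewrite lt ltn_ord /npos /= -addn1 natrD => /(_ isT).
  by lra.
have [i' lt ti'] := tableau_left la_part t_std ti.
have := IH i'; rewrite ti' => /(_ (leq_trans lt ltm)).
have := @gpos_mono i' i; rewrite lt ltn_ord /npos /= -addn1 natrD => /(_ isT).
by lra.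
Qed.

Hypothesis v_incr : forall i j : 'I_l, (i < j)%N -> v i < v j.
Hypothesis v_bound : forall i j : 'I_l, v j < v i + e%:R.

(* There are no ties: two nodes of the same residue and position have the same
   component, because the [v_c] differ by less than [e]. *)
Lemma charge_inj c c' (x x' : int) :
  (e%:Z %| s c + x - (s c' + x'))%Z ->
  charge c + x%:~R = charge c' + x'%:~R -> c = c' /\ x = x'.
Proof.
move=> /dvdzP[z zE] E.
have zv : z%:~R * e%:R = v c - v c' :> rat.
  have := congr1 (fun x : int => x%:~R : rat) zE.
  rewrite rmorphB !rmorphD rmorphM /= => zE'; move: E; rewrite /charge.
  by move: zE'; rewrite -[e%:~R]/(e%:R : rat); lra.
have z0 : z = 0.
  have b1 := v_bound c c'; have b2 := v_bound c' c.
  have e0 : 0 < e%:R :> rat by lra.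
  have : z%:~R * e%:R < 1%:~R * e%:R :> rat by rewrite zv; lra.
  rewrite ltr_pM2r // ltr_int => z1.
  have : (-1)%:~R * e%:R < z%:~R * e%:R :> rat by rewrite zv; lra.
  rewrite ltr_pM2r // ltr_int => z2; lia.
have cc : c = c'.
  have vv : v c = v c' by move: zv; rewrite z0 mul0r; lra.
  apply/val_inj; have [lt|gt|//] := ltngtP (c : nat) c'.
    by have := v_incr lt; rewrite vv ltxx.
  by have := v_incr gt; rewrite vv ltxx.
split=> //; move: zE; rewrite z0 mul0r cc; lia.
Qed.

(** Equal positions and residues give equal components and contents. A node of nonnegative content
    below the first row has a left neighbour in its own row, which by induction is the first one. *)
Lemma eq_greedy_tableau : (forall i, npos (t i) = gpos w i) -> t = wtab n w.
Proof.
have [P1 _ _] := w_greedy.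
move=> all_eq; apply/ffunP => i.
have [m] := ubnP i; elim: m i => // m IH i ltm.
have prev (i' : 'I_n) a b c : (i' < i)%N -> t i' = (a, b, c) -> a = 0%N.
  by move=> lt; rewrite IH ?wtabE //; [move=> [] | exact: leq_trans lt ltm].
case ti : (t i) => [[a b] c].
have [cc bb] : c = w i /\ b%:Z - a%:Z = (wcount w i (w i))%:Z.
  apply: charge_inj.
    have := rpredB (t_res i) (P1 i (ltn_ord i)).
    rewrite ti /nres /=; congr (_ %| _)%Z; ring.
  have := all_eq i; rewrite ti /npos /gpos /= => <-.
  by rewrite rmorphB /= addrA.
have a0 : a = 0%N.
  case: a ti bb => // a; case: b => [|b] ti bb; first by lia.
  have [i' lt ti'] := tableau_left la_part t_std ti.
  by have := prev _ _ _ _ lt ti'.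
rewrite wtabE a0 cc; congr (_, _, _); lia.
Qed.

End Positions.

(** * The dominance order *)

Section SortedSums.
Implicit Types (r : seq rat) (y : rat).

Local Notation dsort := (sort >=%R).

Lemma dsort_le r i j : (i <= j < size r)%N -> nth 0 (dsort r) j <= nth 0 (dsort r) i.
Proof.
case/andP=> ij jr.
have so : sorted >=%R (dsort r) by apply: sort_sorted => x y; exact: le_total.
have tr : transitive (>=%R : rel rat) by move=> x y z h1 h2; exact: le_trans h2 h1.
apply: (sorted_leq_nth tr (fun x : rat => lexx x) 0 so) => //.
  by rewrite inE size_sort; lia.
by rewrite inE size_sort.
Qed.

Lemma lt_dsort r y i : (i < size r)%N ->
  (y < nth 0 (dsort r) i) = (i < count (> y) r)%N.
Proof.
move=> ir; have /permP/(_ (> y)) <- : perm_eq (dsort r) r by rewrite perm_sort.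
set S := dsort r; have sz : size S = size r by rewrite size_sort.
case: ltP => yi; symmetry; last first.
  rewrite -(cat_take_drop i S) count_cat.
  have -> : count (> y) (drop i S) = 0%N.
    apply/eqP; rewrite -leqn0 leqNgt -has_count; apply/(has_nthP 0) => -[j].
    rewrite size_drop nth_drop => jr; apply/negP; rewrite -leNgt.
    by apply: le_trans yi; apply: dsort_le; move: jr; rewrite sz; lia.
  apply/negbTE; rewrite addn0 -leqNgt; apply: leq_trans (count_size _ _) _.
  by rewrite size_takel // sz ltnW.
rewrite -(cat_take_drop i.+1 S) count_cat.
have /eqP -> : count (> y) (take i.+1 S) == size (take i.+1 S).
  rewrite -all_count; apply/(all_nthP 0) => j; rewrite size_takel ?sz // ltnS => ji.
  by rewrite nth_take //=; apply: lt_le_trans yi _; apply: dsort_le; lia.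
by rewrite size_takel ?sz // ltnS leq_addr.
Qed.

(** The sum of the [t] largest entries is the minimum over y of t y + [excess y r]. As the excess
    ignores the order of the entries, this turns partial sums of sorted sequences into plain
    sums. *)
Definition excess y r : rat := \sum_(x <- r) Num.max (x - y) 0.

Lemma excess_dsort y r : excess y r = \sum_(i < size r) Num.max (nth 0 (dsort r) i - y) 0.
Proof.
rewrite /excess -(perm_big _ (introT permPl (perm_sort >=%R r))) (big_nth 0).
by rewrite size_sort big_mkord.
Qed.

Lemma top_sum_le y r t : (t <= size r)%N ->
  \sum_(i < t) nth 0 (dsort r) i <= t%:R * y + excess y r.
Proof.
move=> tr; rewrite excess_dsort.
rewrite -(big_mkord xpredT (fun i => Num.max (nth 0 (dsort r) i - y) 0)).
rewrite (big_cat_nat (leq0n t) tr) /= !big_mkord addrA.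
have : \sum_(i < t) nth 0 (dsort r) i <=
    t%:R * y + \sum_(i < t) Num.max (nth 0 (dsort r) i - y) 0.
  rewrite mulr_natl -[t in y *+ t]card_ord -sumr_const -big_split /=.
  by apply: ler_sum => i _; rewrite -lerBlDl le_max lexx.
move=> /le_trans; apply; rewrite lerDl; apply: sumr_ge0 => i _.
by rewrite le_max lexx orbT.
Qed.

Lemma top_sum_eq y r t : (t <= size r)%N ->
  (forall i, (i < t)%N -> y <= nth 0 (dsort r) i) ->
  (forall i, (t <= i < size r)%N -> nth 0 (dsort r) i <= y) ->
  \sum_(i < t) nth 0 (dsort r) i = t%:R * y + excess y r.
Proof.
move=> tr hi lo; rewrite excess_dsort.
rewrite -(big_mkord xpredT (fun i => Num.max (nth 0 (dsort r) i - y) 0)).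
rewrite (big_cat_nat (leq0n t) tr) /= !big_mkord.
have -> : \sum_(t <= i < size r) Num.max (nth 0 (dsort r) i - y) 0 = 0.
  rewrite big_nat; apply: big1 => i /lo le; apply/max_idPr; lra.
rewrite addr0 mulr_natl -[t in y *+ t]card_ord -sumr_const -big_split /=.
apply: eq_bigr => i _; have /max_idPl -> : 0 <= nth 0 (dsort r) i - y.
  by rewrite subr_ge0 hi.
by rewrite addrC subrK.
Qed.

End SortedSums.

Lemma count_iota_prefix (g : pred nat) j T : (forall a, g a.+1 -> g a) ->
  (count g (iota 0 j.+1) <= j)%N -> (j < T)%N ->
  count g (iota 0 T) = count g (iota 0 j.+1).
Proof.
move=> dec cj jT; have {dec} dec a d : g (a + d)%N -> g a.
  by elim: d => [|d IH]; rewrite ?addn0 // addnS => /dec.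
have [a aj nga] : exists2 a, (a <= j)%N & ~~ g a.
  apply: contrapT => none; move: cj; rewrite leqNgt => /negP; apply.
  have /eqP -> : count g (iota 0 j.+1) == size (iota 0 j.+1); last by rewrite size_iota.
  rewrite -all_count; apply/allP => a; rewrite mem_iota add0n ltnS => /andP[_ aj].
  by apply: contrapT => /negP nga; apply: none; exists a.
rewrite -[in LHS](subnKC jT) iotaD count_cat.
have -> : count g (iota (0 + j.+1) (T - j.+1)) = 0%N; last by rewrite addn0.
apply/eqP; rewrite -leqn0 leqNgt -has_count; apply/hasP => -[b].
rewrite mem_iota add0n => /andP[jb _] gb; case/negP: nga.
by apply: (dec a (b - a)%N); rewrite subnKC //; lia.
Qed.

Section Kappa.
Variables (l n : nat) (s : 'I_l -> int) (v : 'I_l -> rat).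

Local Notation m := (charge s v).
Local Notation kappa := (kappa s v).

(** Shifted beta-numbers, cut off after [T] rows. [kappa] takes a different cut for each index,
    whereas partial sums require a common one. *)
Definition beads (la : mpart l) (T : nat) : seq rat :=
  [seq (part la c a)%:R - a.+1%:R + m c | c <- enum 'I_l, a <- iota 0 T].

Lemma count_beads (p : pred rat) la T : count p (beads la T) =
  (\sum_(c < l) count (fun a => p ((part la c a)%:R - a.+1%:R + m c)%R) (iota 0 T))%N.
Proof.
rewrite /beads count_flatten sumnE 2!big_map big_enum /=.
by apply: eq_bigr => c _; rewrite count_map.
Qed.

Lemma size_beads la T : size (beads la T) = (l * T)%N.
Proof. by rewrite size_allpairs size_enum_ord size_iota. Qed.

Hypothesis l_gt0 : (0 < l)%N.

Lemma le_size_beads la T : (T <= size (beads la T))%N.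
Proof. by rewrite size_beads leq_pmull. Qed.

Section Shape.
Variable la : mpart l.
Hypothesis la_part : is_mpart n la.

Lemma bead_dec y c a : y < (part la c a.+1)%:R - a.+2%:R + m c ->
  y < (part la c a)%:R - a.+1%:R + m c.
Proof.
move=> /lt_le_trans; apply; rewrite lerD2r.
have : (part la c a.+1)%:R <= (part la c a)%:R :> rat.
  by rewrite ler_nat (part_sorted la_part).
by rewrite -(addn1 a.+1) natrD; lra.
Qed.

(** The beads of a component decrease strictly, so a bead outside the first i + 1 rows is preceded
    by i + 1 larger ones and cannot affect the entry of index [i]. *)
Lemma kappa_beads i T : (i < T)%N -> kappa la i = nth 0 (sort >=%R (beads la T)) i.
Proof.
move=> iT; rewrite /Defs.kappa -/(beads la i.+1).
have li : (i < size (beads la i.+1))%N by apply: leq_trans (le_size_beads _ _).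
have lT : (i < size (beads la T))%N by apply: leq_trans (le_size_beads _ _).
apply/eqP; rewrite eq_le; apply/andP; split; rewrite leNgt; apply/negP => lt.
  move: lt; set y := (X in X < _); rewrite lt_dsort // count_beads => ci.
  have : y < y.
    rewrite {2}/y lt_dsort // count_beads; apply: leq_trans ci _.
    apply: leq_sum => c _; rewrite -[in leqRHS](subnKC iT) iotaD count_cat.
    exact: leq_addr.
  by rewrite ltxx.
have := lt; rewrite lt_dsort // count_beads => cT.
have /negP : ~~ (nth 0 (sort >=%R (beads la i.+1)) i < nth 0 (sort >=%R (beads la i.+1)) i).
  by rewrite ltxx.
apply; rewrite lt_dsort // ltnNge; apply/negP => ci.
have : (\sum_(c < l) count (fun a => (nth 0 (sort >=%R (beads la i.+1)) i <
    (part la c a)%:R - a.+1%:R + m c)%R) (iota 0 T) <= i)%N.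
  rewrite count_beads in ci; apply: (leq_trans _ ci); apply: leq_sum => c _.
  rewrite (count_iota_prefix _ _ iT) //; first by move=> a; exact: bead_dec.
  by apply: leq_trans ci; rewrite (bigD1 c) //= leq_addr.
by rewrite leqNgt cT.
Qed.

(** The growth of max(x, 0) over a unit step ending at the argument: what one node adds to the
    excess. *)
Definition clamp (x : rat) : rat := Num.min 1 (Num.max x 0).

Lemma clampS (x : rat) : Num.max (x + 1) 0 = Num.max x 0 + clamp (x + 1).
Proof.
by rewrite /clamp !maxEle !minEle; do ![case: leP => ?]; lra.
Qed.

(** Starting from empty rows, each node moves a bead up by one, to the position [npos] of the
    node. *)
Lemma excess_beads y (t : {ffun 'I_n -> node l}) T : standard la t -> (n <= T)%N ->
  excess y (beads la T) =
  \sum_(c < l) \sum_(a < T) Num.max (m c - a.+1%:R - y) 0 +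
  \sum_(i < n) clamp (npos s v (t i) - y).
Proof.
move=> t_std nT; rewrite (tableau_sum la_part t_std (fun x => clamp (npos s v x - y)) nT).
rewrite -big_split /= /excess big_allpairs_dep /= big_enum /=; apply: eq_bigr => c _.
rewrite -big_split /=.
rewrite -(big_mkord xpredT (fun a => Num.max (m c - a.+1%:R - y) 0 +
   \sum_(b < part la c a) clamp (npos s v (a, nat_of_ord b, c) - y))).
rewrite /index_iota subn0; apply: eq_bigr => a _.
elim: (part la c a) => [|L IH]; first by rewrite big_ord0 addr0; congr (Num.max _ _); ring.
rewrite big_ord_recr /= [RHS]addrA -IH /npos /= -(addn1 a) -(addn1 L) !natrD.
have -> : L%:R + 1 - (a%:R + 1) + m c - y = (L%:R - (a%:R + 1) + m c - y) + 1 by lra.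
rewrite clampS; congr (_ + clamp _); lra.
Qed.

End Shape.

(** Rows beyond [n] are empty and their beads tend to minus infinity, so each component has
    boundedly many beads above [y]. *)
Lemma bead_count_bound la y : is_mpart n la ->
  exists N, forall T, (count (> y) (beads la T) <= N)%N.
Proof.
move=> la_part.
have [B Bn] : exists B, forall c : 'I_l, m c - y < B%:R.
  have : forall c : 'I_l, exists B, m c - y < B%:R.
    move=> c; exists (Num.bound `|m c - y|).
    by apply: le_lt_trans (ler_norm _) _; apply: archi_boundP.
  move=> /choice[B BP]; exists (\sum_c B c)%N => c.
  apply: lt_le_trans (BP c) _; rewrite ler_nat (bigD1 c) //=; exact: leq_addr.
pose T0 := maxn n B; exists (l * T0)%N => T; rewrite count_beads.
apply: leq_trans (_ : (\sum_(c < l) T0 <= _)%N); last by rewrite sum_nat_const card_ord.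
apply: leq_sum => c _; set g := fun a => _.
have gT0 a : (T0 <= a)%N -> ~~ g a.
  move=> le; rewrite /g (part0 la_part); last by lia.
  rewrite -leNgt; have := Bn c.
  have : B%:R <= a%:R :> rat by rewrite ler_nat; lia.
  by rewrite -(addn1 a) natrD; lra.
have [le|lt] := leqP T T0.
  by apply: leq_trans (count_size _ _) _; rewrite size_iota.
rewrite -(subnKC (ltnW lt)) iotaD count_cat.
have -> : count g (iota (0 + T0) (T - T0)) = 0%N.
  apply/eqP; rewrite -leqn0 leqNgt -has_count; apply/hasP => -[a].
  by rewrite mem_iota add0n => /andP[/gT0/negP].
by rewrite addn0; apply: leq_trans (count_size _ _) _; rewrite size_iota.
Qed.

Section Dominance.
Variables (mu la : mpart l) (t t' : {ffun 'I_n -> node l}).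
Hypothesis mu_part : is_mpart n mu.
Hypothesis la_part : is_mpart n la.
Hypothesis t_std : standard mu t.
Hypothesis t'_std : standard la t'.
Hypothesis npos_le : forall i, npos s v (t i) <= npos s v (t' i).

Lemma clamp_mono : {homo clamp : x y / x <= y}.
Proof.
move=> x y xy; rewrite /clamp; case: (leP x 0) => ?; case: (leP y 0) => ?;
  case: (leP 1 x) => ?; case: (leP 1 y) => ?; rewrite ?(min_r (@ler01 rat)); lra.
Qed.

(** With the threshold at the last entry summed for [la], the excess formula is exact for [la] and
    an upper bound for [mu], and the excess is monotone in the positions. *)
Lemma kappa_sum_le N : \sum_(i < N) kappa mu i <= \sum_(i < N) kappa la i.
Proof.
have [->|N0] := posnP N; first by rewrite !big_ord0.
pose T := maxn N n; have NT : (N <= T)%N by exact: leq_maxl.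
have nT : (n <= T)%N by exact: leq_maxr.
under eq_bigr => i _ do rewrite (kappa_beads mu_part (leq_trans (ltn_ord i) NT)).
under [leRHS]eq_bigr => i _ do rewrite (kappa_beads la_part (leq_trans (ltn_ord i) NT)).
have sz la' : (N <= size (beads la' T))%N := leq_trans NT (le_size_beads la' T).
pose y := nth 0 (sort >=%R (beads la T)) N.-1.
rewrite (@top_sum_eq y (beads la T)) //.
- apply: le_trans (@top_sum_le y _ _ (sz mu)) _.
  rewrite lerD2l (excess_beads mu_part y t_std nT) (excess_beads la_part y t'_std nT).
  by rewrite lerD2l; apply: ler_sum => i _; apply: clamp_mono; rewrite lerD2r.
- by move=> i iN; apply: dsort_le; have := sz la; lia.
- by move=> i /andP[Ni isz]; apply: dsort_le; lia.
Qed.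

(** At the threshold [npos s v (t i0)] the node of index [i0] contributes nothing for [mu] and a
    positive amount for [la], so the excesses differ. *)
Lemma kappa_neq i0 : npos s v (t i0) < npos s v (t' i0) ->
  exists i, kappa mu i <> kappa la i.
Proof.
move=> lt; apply: contrapT => all_eq.
have eqk i : kappa mu i = kappa la i by apply: contrapT => ne; apply: all_eq; exists i.
pose y := npos s v (t i0).
have [B BP] := bead_count_bound y la_part.
have ex_small : exists N, kappa la N <= y.
  exists B; rewrite (kappa_beads la_part (ltnSn B)) leNgt lt_dsort; last exact: le_size_beads.
  by rewrite ltnNge BP.
(* [N] is the number of entries of [kappa la] above the threshold, which makes the formula exact for
   [la]. *)
case: (ex_minnP ex_small) => N leN minN.
pose T := maxn N.+1 n; have NT : (N < T)%N by exact: leq_maxl.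
have nT : (n <= T)%N by exact: leq_maxr.
have sz la' : (N <= size (beads la' T))%N := leq_trans (ltnW NT) (le_size_beads la' T).
have : \sum_(i < N) kappa mu i = \sum_(i < N) kappa la i by apply: eq_bigr.
under eq_bigr => i _ do rewrite (kappa_beads mu_part (ltn_trans (ltn_ord i) NT)).
under [RHS]eq_bigr => i _ do rewrite (kappa_beads la_part (ltn_trans (ltn_ord i) NT)).
rewrite (@top_sum_eq y (beads la T)) //; last 2 first.
- move=> i iN; rewrite -(kappa_beads la_part (ltn_trans iN NT)) ltW // ltNge.
  by apply/negP => /minN; rewrite leqNgt iN.
- move=> i /andP[Ni isz]; apply: le_trans leN; rewrite (kappa_beads la_part NT).
  by apply: dsort_le; lia.
move=> E; have := @top_sum_le y _ _ (sz mu); rewrite E lerD2l.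
rewrite (excess_beads mu_part y t_std nT) (excess_beads la_part y t'_std nT) lerD2l.
rewrite leNgt => /negP; apply; rewrite (bigD1 i0) //= [ltRHS](bigD1 i0) //=.
apply: ltr_leD; last first.
  by apply: ler_sum => i _; apply: clamp_mono; rewrite lerD2r.
have lt' : 0 < npos s v (t' i0) - y by rewrite subr_gt0.
by rewrite subrr /clamp maxxx (min_r (@ler01 rat)) (max_l (ltW lt')) lt_min ltr01.
Qed.

End Dominance.
End Kappa.

(** * One-row modules *)

Lemma mx_dim1 (F : comNzRingType) d (X : 'M[F]_d) : d = 1%N -> exists a, X = a%:M.
Proof. by move=> d1; subst; exists (X 0 0); exact: mx11_scalar. Qed.

Lemma mrow_rows l n (j : 'I_l) : mrow n j = rows n (fun=> j).
Proof.
apply/ffunP => c; rewrite !ffunE wcount_const.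
by case: eqP => // _; case: n.
Qed.

Lemma mrow_tableau l n (j : 'I_l) (t : {ffun 'I_n -> node l}) :
  standard (rows n (fun=> j)) t -> t = wtab n (fun=> j).
Proof.
move=> stt; have [inj_t dia_t mono_t] := stt; have part := rows_mpart n (fun=> j).
have countE i : wcount (fun=> j) i j = i.
  by rewrite wcount_const eqxx.
have shape i : exists2 b, (b < n)%N & t i = (0%N, b, j).
  case E : (t i) => [[a b] c]; have := dia_t i; rewrite E => dia.
  have a0 := rows_onerow dia; move: dia; rewrite a0 /in_diagram part_rows /=.
  have [->|ne] := eqVneq c j; first by rewrite countE; exists b.
  by rewrite wcount_const (negPf ne).
suff main : forall i : 'I_n, t i = (0%N, nat_of_ord i, j).
  by apply/ffunP => i; rewrite main wtabE countE.
move=> i; have [m] := ubnP i; elim: m i => // m IH i ltm.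
have [b bn tb] := shape i; rewrite tb; congr (_, _, _).
have [lt|gt|//] := ltngtP b i.
  have := IH (Ordinal bn) (leq_trans lt ltm); rewrite /= -tb => /inj_t /(congr1 val) /= bi.
  by rewrite bi ltnn in lt.
have [|i2 ti2] := tableau_surj part stt (x := (0%N, nat_of_ord i, j)).
  by rewrite /in_diagram part_rows /= countE.
have lt2 : (i2 < i)%N by apply: mono_t; rewrite ti2 tb //=; left.
by have := IH i2 (leq_trans lt2 ltm); rewrite ti2 => -[e]; rewrite e ltnn in lt2.
Qed.

Section Lattice.
Variables (A : comNzRingType) (K : fieldType) (inc : {rmorphism A -> K}).
Variables (l n : nat) (q qi : A) (Q : 'I_l -> A) (V : mxmod A).

Local Notation tableau := {ffun 'I_n -> node l}.
Local Notation W := (map_mxmod inc V).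
Local Notation jcont := (jcont q qi Q).

Hypothesis qqi : q * qi = 1.
Hypothesis inc_inj : injective inc.

Lemma KV_basis (la : mpart l) : is_KV n (inc q) (fun c => inc (Q c)) la W ->
  exists (ts : (rdim V).-tuple tableau) (P : 'M[K]_(rdim V)),
    [/\ uniq ts, forall t, t \in ts <-> standard la t, P \in unitmx &
      forall (r : 'I_(rdim V)) (i : 'I_n), row r P *m ev W (jword i) =
        inc (jcont i (tnth ts r i)) *: row r P].
Proof.
case=> _ _ [ts [P [uts tsP uP Pjm]]]; exists ts, P; split=> // r i.
have q0 : inc q != 0.
  apply/eqP => q0; have := congr1 inc qqi; rewrite rmorphM q0 mul0r rmorph1.
  by move/esym/eqP; rewrite oner_eq0.
have qiE : inc qi = (inc q)^-1.
  by apply: (mulfI q0); rewrite -rmorphM qqi rmorph1 mulfV.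
have := Pjm r i; rewrite jucys_murphyE -scalemxAr /= => /(canRL (scalerK _)) ->.
  rewrite scalerA invrK /jcont /cont !rmorphM !rmorphXn /= qiE.
  by rewrite expfzDr // exprVn exprnN -exprnP !mulrA.
by rewrite invr_eq0 expf_neq0.
Qed.

Hypothesis generic : forall c c' x x', Q c * q ^+ x = Q c' * q ^+ x' ->
  c = c' /\ x = x'.

Lemma mrow_character (j : 'I_l) : AK_relations n q Q V ->
  is_KV n (inc q) (fun c => inc (Q c)) (mrow n j) W ->
  rdim V = 1%N /\
  forall i, (i < n)%N -> V i = (if i == 0%N then Q j else q)%:M.
Proof.
move=> relV /KV_basis[ts [P [uts tsP uP Pjm]]].
have tsE t : t \in ts <-> t = wtab n (fun=> j).
  rewrite tsP mrow_rows; split=> [/mrow_tableau //|->].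
  by apply: wtab_standard; exact: rearrangement_refl.
have d1 : rdim V = 1%N.
  rewrite -(size_tuple ts); apply: (@perm_size _ _ [:: wtab n (fun=> j)]).
  apply: uniq_perm => // t; rewrite inE; apply/idP/eqP => [/tsE //|tE]; exact/tsE.
split=> //; have xex i : exists a, V i = a%:M by exact: mx_dim1.
have [x xE] := choice xex.
have evE h : ev V h = (chiw x h)%:M.
  elim: h => [|i h IH] /=; first by rewrite /chiw big_nil.
  by rewrite IH xE -scalar_mxM /chiw big_cons.
have r0 : 'I_(rdim V) by rewrite d1; exact: ord0.
have row0 : row r0 P != 0.
  apply/eqP => P0; have /row_freeP[P' PP'] : row_free P by rewrite row_free_unit.
  have := congr1 (row r0) PP'; rewrite row_mul P0 mul0mx => /rowP/(_ r0).
  by rewrite !mxE eqxx => /esym/eqP; rewrite oner_eq0.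
have jE i : (i < n)%N -> chiw x (jword i) = q ^+ i * (Q j * q ^+ i).
  move=> lti; have := Pjm r0 (Ordinal lti).
  have /tsE -> := mem_tnth r0 ts; rewrite -map_ev evE map_scalar_mx mul_mx_scalar.
  move/eqP; rewrite -subr_eq0 -scalerBl scaler_eq0 (negPf row0) orbF subr_eq0.
  move=> /eqP/inc_inj ->; rewrite wtabE /jcont /cont /= expr0 mulr1.
  by rewrite wcount_const eqxx.
have x0 : (0 < n)%N -> x 0%N = Q j.
  by move/jE; rewrite /chiw big_seq1 expr0 mul1r mulr1.
have Q0 i : inc (Q j) * inc q ^+ i != 0.
  rewrite -rmorphXn -rmorphM; apply/eqP; rewrite -(rmorph0 inc) => /inc_inj E.
  have := @generic j j i i.+1; rewrite exprSr mulrA E mul0r => /(_ erefl)[_].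
  by lia.
have xq i : (i.+1 < n)%N -> x i.+1 = q.
  move=> lti; have /(congr1 inc) := jE _ lti; have /(congr1 inc) := jE _ (ltnW lti).
  rewrite jwordS /chiw big_cons big_rcons /= -/(chiw _ _) !rmorphM !rmorphXn => ->.
  move=> E; have x2 : inc (x i.+1) ^+ 2 = inc q ^+ 2.
    apply: (mulfI (Q0 i)); apply: (mulfI (_ : inc q ^+ i != 0)).
      by apply: contra_neq (Q0 i) => ->; rewrite mulr0.
    transitivity (inc q ^+ i.+1 * (inc (Q j) * inc q ^+ i.+1)); last by rewrite exprS; ring.
    by rewrite -E; ring.
  have := quad relV (_ : (1 <= i.+1 < n)%N); rewrite lti xE => /(_ isT) /matrixP/(_ r0 r0).
  rewrite -scalar_mxM !mxE eqxx !mulr1n => /(congr1 inc).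
  rewrite rmorphM rmorphD rmorphM rmorphB rmorph1 -expr2 x2 => E2.
  have q1 : inc q - 1 != 0.
    rewrite subr_eq0 -(rmorph1 inc); apply/eqP => /inc_inj q1.
    by have := @generic j j 0%N 1%N; rewrite q1 !expr1n => /(_ erefl)[].
  by apply/inc_inj/(mulfI q1)/(addIr (inc q)); rewrite -E2; ring.
by move=> [|i] lti; rewrite xE ?x0 ?xq.
Qed.

End Lattice.

(** * Greedy words *)

Section GreedyOrder.
Variables (l n e : nat) (s : 'I_l -> int) (v : 'I_l -> rat) (k : int).
Variable w : nat -> 'I_l.
Hypothesis w_greedy : greedy n e s v k w.

Lemma wcount_add i d c : (wcount w (i + d) c <= wcount w i c + d)%N.
Proof.
by elim: d => [|d IH]; rewrite ?addn0 // !addnS wcountS; case: eqP => _; lia.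
Qed.

Lemma gpos_add i d : (i + d < n)%N -> gpos s v w i + d%:R <= gpos s v w (i + d).
Proof.
have [_ P2 _] := w_greedy; elim: d => [|d IH] lt; first by rewrite addn0 addr0.
rewrite addnS in lt *; have := IH (ltnW lt); have := P2 _ lt.
by rewrite -(addn1 d) natrD; lra.
Qed.

(* Each letter occupies an interval of a greedy word: [gpos] grows by at least
   one at each step, but only by one between two occurrences of a letter. *)
Lemma greedy_interval i j : (i < j < n)%N -> w i = w j -> w j.-1 = w j.
Proof.
case/andP=> ij jn wij; apply: contrapT => ne.
have := @gpos_add i (j - i); rewrite (subnKC (ltnW ij)) => /(_ jn).
rewrite /gpos -wij -addrA lerD2l -natrD ler_nat.
have -> : wcount w j (w i) = wcount w j.-1 (w i).
  by rewrite -[in LHS](prednK (leq_ltn_trans (leq0n i) ij)) wcountS wij; case: eqP => // _; rewrite addn0.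
have := wcount_add i (j.-1 - i) (w i); rewrite subnKC; lia.
Qed.

(** After [d] steps the position has grown by at least [d], and at most [d] of it is due to earlier
    occurrences of the letter. *)
Lemma greedy_charge d : (d < n)%N -> charge s v (w 0%N) <= charge s v (w d).
Proof.
move=> dn; have := @gpos_add 0 d dn; rewrite add0n /gpos.
have : (wcount w d (w d))%:R <= d%:R :> rat.
  by rewrite ler_nat; have := wcount_add 0 d (w d); rewrite add0n.
have -> : wcount w 0 (w 0%N) = 0%N by [].
lra.
Qed.

(** The order of first occurrence. As letters occupy intervals, it increases along a greedy word, as
    the permutation module demands of [w0]. *)
Definition wrank (c : 'I_l) : nat := index c (mkseq w n).

Lemma wrank_inj i i' : (i < n)%N -> (i' < n)%N ->
  wrank (w i) = wrank (w i') -> w i = w i'.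
Proof.
move=> lti lti' E; have mem a : (a < n)%N -> w a \in mkseq w n.
  by move=> lta; apply/mapP; exists a; rewrite // mem_iota.
by rewrite -(nth_index (w 0%N) (mem _ lti)) -/(wrank _) E nth_index // mem.
Qed.

Lemma wrank_sorted j : (0 < j < n)%N -> (wrank (w j.-1) <= wrank (w j))%N.
Proof.
case/andP=> j0 jn; rewrite leqNgt; apply/negP => lt.
have rank_le a : (a < n)%N -> (wrank (w a) <= a)%N.
  move=> lta; rewrite -ltnS; apply: index_ltn.
  rewrite /mkseq -map_take take_iota (minn_idPl lta).
  by apply/mapP; exists a; rewrite // mem_iota ltnS leqnn.
have := rank_le j.-1; have ltj : (wrank (w j) < j)%N by have := rank_le j.-1; lia.
move=> _; have E : w (wrank (w j)) = w j.
  have mem : w j \in mkseq w n by apply/mapP; exists j; rewrite // mem_iota.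
  by have := nth_index (w 0%N) mem; rewrite nth_mkseq // (leq_trans ltj) // ltnW.
have := @greedy_interval (wrank (w j)) j; rewrite ltj jn => /(_ isT E) wE.
by rewrite wE ltnn in lt.
Qed.

End GreedyOrder.

Section GreedyWords.
Variables (l e : nat) (s : 'I_l -> int) (v : 'I_l -> rat) (alpha : nat -> 'I_l).
Hypothesis e_gt0 : (0 < e)%N.
Hypothesis v_incr : forall i j : 'I_l, (i < j)%N -> v i < v j.
Hypothesis v_bound : forall i j : 'I_l, v j < v i + e%:R.
Hypothesis alphaP : forall k1, res_set e s k1 -> is_alpha e s k1 (alpha k1).

Local Notation m := (charge s v).
Local Notation res := (res_set e s).

(* [k] jumps to [k1]: the first row of [alpha k1] beats the continuation of
   the first row of [alpha k] at the residue [k1]. *)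
Definition jumps (k k1 : nat) : Prop :=
  s (alpha k1) > s (alpha k) + e%:Z \/
  [/\ s (alpha k1) > s (alpha k), s (alpha k) > s (alpha k1) - e%:Z &
      (alpha k1 < alpha k)%N].

Lemma alpha_mod k : res k -> (e%:Z %| s (alpha k) - k%:Z)%Z.
Proof.
by move=> rk; have [[/eqP E _] _] := alphaP rk; rewrite eqz_mod_dvd in E.
Qed.

Lemma mod_lt (x y : int) : (e%:Z %| x - y)%Z -> x < y -> x + e%:Z <= y.
Proof.
move=> /dvdzP[z zE] lt; have : z * e%:Z < 0 * e%:Z by rewrite -zE; lia.
rewrite ltr_pM2r ?ltz_nat // => z0.
have : z * e%:Z <= (-1) * e%:Z by rewrite ler_pM2r ?ltz_nat //; lia.
lia.
Qed.

Lemma mod_eq0 (x : int) : (e%:Z %| x)%Z -> - e%:Z < x < e%:Z -> x = 0.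
Proof.
move=> d /andP[lo hi]; apply: le_anti; rewrite !leNgt; apply/andP; split; apply/negP => lt.
  by have := @mod_lt 0 x; rewrite sub0r rpredN => /(_ d lt); lia.
by have := @mod_lt x 0; rewrite subr0 => /(_ d lt); lia.
Qed.

Lemma int_rat_le (x y : int) : (x <= y) = (x%:~R <= y%:~R :> rat).
Proof. by rewrite ler_int. Qed.

Lemma res_eq k k1 : res k -> res k1 -> (e%:Z %| s (alpha k1) - s (alpha k))%Z -> k1 = k.
Proof.
move=> rk rk1 d; have [ke _] := rk; have [k1e _] := rk1.
have : (e%:Z %| k1%:Z - k%:Z)%Z.
  have := rpredD (rpredB d (alpha_mod rk1)) (alpha_mod rk).
  by congr (_ %| _)%Z; ring.
by move/mod_eq0; lia.
Qed.

Lemma res_diffP k k1 : (e%:Z %| k1%:Z - k%:Z - (res_diff e k k1)%:Z)%Z.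
Proof.
have e0 : e%:Z != 0 by lia.
by rewrite /res_diff (gez0_abs (modz_ge0 _ e0)) -eqz_mod_dvd modz_mod.
Qed.

Lemma res_diff_lt k k1 : (res_diff e k k1 < e)%N.
Proof.
rewrite /res_diff; have e0 : e%:Z != 0 by lia.
have := modz_ge0 (k1%:Z - k%:Z) e0; have : ((k1%:Z - k%:Z) %% e%:Z)%Z < e%:Z.
  by apply: ltz_pmod; lia.
lia.
Qed.

(** Congruent integers that differ do so by at least [e], which outweighs any difference of the
    [v]. *)
Lemma charge_mod_le (c c' : 'I_l) (x : int) :
  (e%:Z %| s c - (s c' + x))%Z -> s c < s c' + x -> m c < m c' + x%:~R.
Proof.
move=> d lt; have := mod_lt d lt; rewrite int_rat_le !rmorphD /= /charge.
have := v_bound c c'; rewrite -[e%:~R]/(e%:R : rat); lra.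
Qed.

Lemma charge_alpha c k : res k -> (e%:Z %| s c - k%:Z)%Z -> m c <= m (alpha k).
Proof.
move=> rk d; have [[/eqP ak maxa] mina] := alphaP rk.
have /eqP dc : (s c == k%:Z %[mod e%:Z])%Z by rewrite eqz_mod_dvd.
have [lt|ge] := ltP (s c) (s (alpha k)).
  have := @charge_mod_le c (alpha k) 0; rewrite !addr0 => h; apply: ltW; apply: h => //.
  have := rpredB d (alpha_mod rk); congr (_ %| _)%Z; ring.
have eqs : s c = s (alpha k) by apply: le_anti; rewrite ge maxa.
have le := mina c; have {le}le : (alpha k <= c)%N.
  by apply: mina; split=> // j /maxa; rewrite eqs.
rewrite /charge eqs lerD2l lerN2.
move: le; rewrite leq_eqVlt => /orP[/eqP/val_inj -> //|/v_incr/ltW //].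
Qed.

Lemma res_diff_gt0 k k1 : res k -> res k1 -> k1 <> k -> (0 < res_diff e k k1)%N.
Proof.
move=> [ke _] [k1e _] ne; rewrite lt0n; apply/eqP => d0.
by have := res_diffP k k1; rewrite d0 subr0 => /mod_eq0 E; apply: ne; lia.
Qed.

Lemma jumps_neq k k1 : jumps k k1 -> k1 <> k.
Proof. by move=> [lt|[lt _ _]] E; rewrite E in lt; lia. Qed.

(** Beyond a gap of [e], congruence makes the gap at least j + e, which outweighs the [v]. Otherwise
    the gap is exactly j and the order of the indices decides. *)
Lemma jumps_charge k k1 : res k -> res k1 -> jumps k k1 ->
  m (alpha k) + (res_diff e k k1)%:R <= m (alpha k1).
Proof.
move=> rk rk1 jk; have ne := jumps_neq jk.
have j0 := res_diff_gt0 rk rk1 ne; have je := res_diff_lt k k1.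
set j := res_diff _ _ _ in j0 je *.
have dj : (e%:Z %| s (alpha k1) - s (alpha k) - j%:Z)%Z.
  have := rpredD (rpredB (alpha_mod rk1) (alpha_mod rk)) (res_diffP k k1).
  by rewrite -/j; congr (_ %| _)%Z; ring.
case: jk => [lt|[lt gt a_lt]].
  have : s (alpha k) + j%:Z + e%:Z <= s (alpha k1).
    apply: mod_lt; last by lia.
    by rewrite (_ : _ - _ = - (s (alpha k1) - s (alpha k) - j%:Z)) ?rpredN //; ring.
  rewrite int_rat_le !rmorphD /= /charge; have := v_bound (alpha k) (alpha k1).
  by rewrite -[e%:~R]/(e%:R : rat) -[j%:~R]/(j%:R : rat); lra.
have -> : j%:R = (s (alpha k1) - s (alpha k))%:~R :> rat.
  have -> : s (alpha k1) - s (alpha k) = j%:Z by have := mod_eq0 dj; lia.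
  by [].
by rewrite rmorphB /= /charge; have := v_incr a_lt; lra.
Qed.

(** Either s_(alpha k1) lies below s_(alpha k) + i, hence by at least [e], or the absence of a jump
    leaves equality with [alpha k] before [alpha k1]. *)
Lemma no_jump_charge k k1 (i : nat) : res k -> res k1 -> k1 <> k -> ~ jumps k k1 ->
  (e%:Z %| k1%:Z - (k%:Z + i%:Z))%Z -> m (alpha k1) <= m (alpha k) + i%:R.
Proof.
move=> rk rk1 ne nj d.
have ds : (e%:Z %| s (alpha k1) - (s (alpha k) + i%:Z))%Z.
  have := rpredD (rpredB (alpha_mod rk1) (alpha_mod rk)) d.
  by congr (_ %| _)%Z; ring.
have [lt|ge] := ltP (s (alpha k1)) (s (alpha k) + i%:Z).
  by have /ltW := charge_mod_le ds lt.
have neq : ~ (e%:Z %| s (alpha k1) - s (alpha k))%Z by move=> /(res_eq rk rk1).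
have ne0 : s (alpha k1) <> s (alpha k) by move=> E; apply: neq; rewrite E subrr dvdz0.
have nee : s (alpha k1) <> s (alpha k) + e%:Z.
  by move=> E; apply: neq; rewrite E addrC addKr dvdzz.
have le : s (alpha k1) < s (alpha k) + e%:Z.
  rewrite ltNge; apply/negP => h; apply: nj; left; lia.
have a_le : (alpha k < alpha k1)%N.
  rewrite ltnNge leq_eqVlt; apply/negP => /orP[/eqP/val_inj E|lt].
    by apply: ne0; rewrite E.
  by apply: nj; right; split=> //; lia.
have eqs : s (alpha k1) = s (alpha k) + i%:Z.
  by have := mod_eq0 ds; lia.
rewrite /charge eqs rmorphD /= -[i%:~R]/(i%:R : rat).
by have := v_incr a_le; lra.
Qed.

(** A component is beaten by the [alpha] of its residue, and the residue of a jump target does not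
    come up during the first [n] steps. *)
Lemma greedy_const n k : res k ->
  (forall k1, res k1 -> jumps k k1 -> (n <= res_diff e k k1)%N) ->
  greedy n e s v k%:Z (fun=> alpha k).
Proof.
move=> rk nojump.
have countE i : wcount (fun=> alpha k) i (alpha k) = i.
  by rewrite wcount_const eqxx.
split=> [i lti|i lti|i c lti d].
- by rewrite countE; have := alpha_mod rk; congr (_ %| _)%Z; ring.
- by rewrite /gpos !countE -(addn1 i) natrD addrA.
rewrite /gpos countE.
have e0 : e%:Z != 0 by lia.
have [k1 k1E] : exists k1 : nat, k1%:Z = (s c %% e%:Z)%Z.
  by exists `|(s c %% e%:Z)%Z|%N; rewrite gez0_abs ?modz_ge0.
have k1c : (e%:Z %| s c - k1%:Z)%Z by rewrite -eqz_mod_dvd k1E modz_mod.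
have rk1 : res k1.
  split; last by exists c; rewrite k1E modz_mod.
  by have := @ltz_pmod (s c) e%:Z; rewrite -k1E; lia.
apply: le_trans (charge_alpha rk1 k1c) _.
have [->|/eqP ne] := eqVneq k1 k; first by rewrite lerDl.
have d1 : (e%:Z %| k1%:Z - (k%:Z + i%:Z))%Z.
  by have := rpredB d k1c; congr (_ %| _)%Z; ring.
apply: no_jump_charge => // jk; have := nojump _ rk1 jk.
have := rpredB (res_diffP k k1) d1; have := res_diff_lt k k1.
have -> : k1%:Z - k%:Z - (res_diff e k k1)%:Z - (k1%:Z - (k%:Z + i%:Z)) =
  i%:Z - (res_diff e k k1)%:Z by ring.
by move=> lte /mod_eq0; lia.
Qed.

Definition wcat (j : nat) (a : 'I_l) (w : nat -> 'I_l) : nat -> 'I_l :=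
  fun i => if (i < j)%N then a else w (i - j)%N.

Lemma wcount_wcat_l j a w i c : (i <= j)%N ->
  wcount (wcat j a w) i c = if c == a then i else 0%N.
Proof.
elim: i => [|i IH] ij; first by rewrite if_same.
by rewrite wcountS IH ?(ltnW ij) // /wcat ij eq_sym; case: eqP; rewrite ?addn1.
Qed.

Lemma wcount_wcat_r j a w d c :
  wcount (wcat j a w) (j + d) c = ((if c == a then j else 0) + wcount w d c)%N.
Proof.
elim: d => [|d IH]; first by rewrite !addn0 wcount_wcat_l.
by rewrite addnS !wcountS IH /wcat ltnNge leq_addr /= addKn addnA.
Qed.

Lemma greedy_cat n j k k1 w : res k -> res k1 -> (0 < j)%N -> (j < n)%N ->
  greedy j e s v k%:Z (fun=> alpha k) ->
  greedy (n - j) e s v k1%:Z w -> w 0%N = alpha k1 ->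
  m (alpha k) + j%:R <= m (alpha k1) -> (e%:Z %| k1%:Z - k%:Z - j%:Z)%Z ->
  greedy n e s v k%:Z (wcat j (alpha k) w).
Proof.
move=> rk rk1 j0 jn [_ _ C3] gw w_0 mj dj; have [P1 P2 P3] := gw.
have countE i : wcount (fun=> alpha k) i (alpha k) = i.
  by rewrite wcount_const eqxx.
have gl i : (i < j)%N -> gpos s v (wcat j (alpha k) w) i = m (alpha k) + i%:R.
  by move=> ij; rewrite /gpos /wcat ij wcount_wcat_l ?eqxx // ltnW.
have gt0j : 0 < j%:R :> rat by rewrite ltr0n.
(* All letters of [w] have charge at least that of [alpha k1], so [alpha k] does not return. *)
have wne d : (d < n - j)%N -> (w d == alpha k) = false.
  move=> dn; apply/eqP => wd; have := greedy_charge gw dn; rewrite wd w_0; lra.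
have wE d : wcat j (alpha k) w (j + d) = w d by rewrite /wcat ltnNge leq_addr /= addKn.
have gr d : (d < n - j)%N -> gpos s v (wcat j (alpha k) w) (j + d) = gpos s v w d.
  by move=> dn; rewrite /gpos wE wcount_wcat_r wne.
split=> [i lti|i lti|i c lti d].
- have [ij|ji] := ltnP i j.
    rewrite {1 3}/wcat ij wcount_wcat_l ?eqxx; last exact: ltnW.
    by have := alpha_mod rk; congr (_ %| _)%Z; ring.
  rewrite -(subnKC ji); set d := (i - j)%N; have dn : (d < n - j)%N by lia.
  rewrite wE wcount_wcat_r wne // add0n.
  have := rpredD (P1 d dn) dj; congr (_ %| _)%Z; rewrite PoszD; ring.
- have [ij|ji] := ltnP i.+1 j.
    by rewrite (gl _ ij) (gl _ (ltnW ij)) -(addn1 i) natrD addrA.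
  have [ji'|ij] := leqP j i.
    rewrite -(subnKC ji') -addnS; set d := (i - j)%N.
    by rewrite !gr; [apply: P2|..]; lia.
  have ij' : i.+1 = (j + 0)%N by lia.
  rewrite gl // ij' gr; last by lia.
  rewrite /gpos w_0 (_ : wcount w 0 _ = 0%N) // addr0; apply: le_trans mj.
  by rewrite -addrA lerD2l -(addn0 j) -ij' -(addn1 i) natrD.
- have [ij|ji] := ltnP i j.
    by rewrite gl //; have := C3 i c ij d; rewrite /gpos countE.
  rewrite -(subnKC ji) gr; last by lia.
  apply: P3; first by lia.
  have -> : s c - (k1%:Z + (i - j)%N%:Z) = s c - (k%:Z + i%:Z) - (k1%:Z - k%:Z - j%:Z).
    by rewrite -subzn //; ring.
  exact: rpredB.
Qed.

(** Follow [alpha k] up to the nearest jump, then recurse on the remaining nodes from its target. *)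
Lemma greedy_ex n k : res k -> exists2 w, w 0%N = alpha k & greedy n e s v k%:Z w.
Proof.
elim/ltn_ind: n k => n IH k rk.
pose good j := `[< exists k1, [/\ res k1, jumps k k1, res_diff e k k1 = j & (j < n)%N] >].
have [ex_good|none] := pselect (exists j, good j); last first.
  exists (fun=> alpha k) => //; apply: greedy_const => // k1 rk1 jk.
  rewrite leqNgt; apply/negP => lt; apply: none; exists (res_diff e k k1).
  by apply/asboolP; exists k1.
case: (ex_minnP ex_good) => j /asboolP[k1 [rk1 jk jE jn]] jmin.
have j0 : (0 < j)%N by rewrite -jE; apply: res_diff_gt0 => //; exact: jumps_neq.
have [|w w_0 gw] := IH (n - j)%N _ k1 rk1; first by lia.
exists (wcat j (alpha k) w); first by rewrite /wcat j0.
apply: (greedy_cat (k1 := k1)) => //; rewrite -?jE.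
- apply: greedy_const => // k2 rk2 jk2; rewrite leqNgt; apply/negP => lt.
  have : good (res_diff e k k2) by apply/asboolP; exists k2; split=> //; lia.
  by move/jmin; lia.
- exact: jumps_charge.
- exact: res_diffP.
Qed.

Lemma rows_wcat n j a w : (j <= n)%N ->
  rows n (wcat j a w) = mpart_add (mrow j a) (rows (n - j) w).
Proof.
move=> jn; apply/ffunP => c; rewrite mrow_rows [RHS]ffunE ffunE.
have -> : wcount (wcat j a w) n c = (wcount (fun=> a) j c + wcount w (n - j) c)%N.
  rewrite -{1}(subnKC jn) wcount_wcat_r; congr (_ + _)%N.
  by rewrite -(wcount_wcat_l a w c (leqnn j)) /wcount; congr count; apply/eq_in_map => i;
    rewrite mem_iota /wcat add0n => /andP[_ ->].
under eq_mkseq do rewrite !part_rows.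
rewrite !ffunE !size_nseq.
by case: (wcount _ j c) => [|x]; case: (wcount w _ c) => [|y] //=; rewrite addn0.
Qed.

End GreedyWords.

(** * The labels *)

Section GroundRing.
Variables (R : realType) (l : nat).

Definition laurent_inc : {rmorphism laurent R l -> Kfrac R l} := \val.

Lemma laurent_inc_inj : injective laurent_inc.
Proof. exact: val_inj. Qed.

Lemma laurent_qV_subproof : (tofrac (polq R l))^-1 \in @is_laurent R l.
Proof. by apply/laurentP; exists (1, 1%N); rewrite tofrac1 expr1 div1r. Qed.

Definition laurent_qV : laurent R l := Laurent laurent_qV_subproof.

Lemma laurent_qqV : @qA R l * laurent_qV = 1.
Proof.
by apply: val_inj; rewrite rmorphM rmorph1 /= mulfV // polq_neq0.
Qed.

Lemma laurent_generic (c c' : 'I_l) (x x' : nat) :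
  @QA R l c * @qA R l ^+ x = @QA R l c' * @qA R l ^+ x' -> c = c' /\ x = x'.
Proof.
move=> /(congr1 laurent_inc); rewrite !rmorphM !rmorphXn /= /polq.
rewrite -!tofracXn -!tofracM => /eqP; rewrite tofrac_eq !mpolyXn -!mpolyXD => /eqP E.
have {}E := congr1 (fun p : {mpoly R[i][l.+1]} =>
  p@_(U_(lift ord0 c) + U_(ord0) *+ x)%MM) E.
move: E; rewrite /= !mcoeffX eqxx; case: eqP => [E _|_ /eqP]; last first.
  by rewrite oner_eq0.
have := congr1 (fun m : 'X_{1.. l.+1} => m ord0) E.
have := congr1 (fun m : 'X_{1.. l.+1} => m (lift ord0 c)) E.
rewrite !mnmDE !mulmnE !mnm1E /= eqxx !mul0n !addn0 !mul1n.
by case: eqP => // /lift_inj -> _; rewrite !add0n => ->.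
Qed.

Variables (eta : R[i]) (s : 'I_l -> int).
Hypothesis eta_neq0 : eta != 0.

Definition theta_morphism : {rmorphism laurent R l -> R[i]} :=
  HB.pack (theta eta s)
    (GRing.isZmodMorphism.Build _ _ (theta eta s) (theta_zmod_morphism s eta_neq0))
    (GRing.isMonoidMorphism.Build _ _ (theta eta s) (theta_monoid_morphism s eta_neq0)).

End GroundRing.

Lemma prim_root_exprz (F : fieldType) (e : nat) (z : F) (x y : int) :
  e.-primitive_root z -> z ^ x = z ^ y <-> (e%:Z %| x - y)%Z.
Proof.
move=> zP; have z0 : z != 0 by rewrite (prim_root_eq0 zP) -lt0n (prim_order_gt0 zP).
have one (t : int) : (z ^ t == 1) = (e%:Z %| t)%Z.
  case: (intP t) => [|n|n]; first by rewrite expr0z eqxx dvdz0.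
    by rewrite -exprnP -(prim_order_dvd zP).
  by rewrite -exprnN invr_eq1 -(prim_order_dvd zP) rpredN.
rewrite -one expfzDr // -invr_expz.
split=> [->|/eqP E]; first by rewrite mulfV // expfz_neq0.
by apply: (mulIf (_ : (z ^ y)^-1 != 0)); rewrite ?invr_eq0 ?expfz_neq0 // E mulfV // expfz_neq0.
Qed.

Section Label.
Variables (R : realType) (l e : nat) (s : 'I_l -> int) (v : 'I_l -> rat).
Variables (eta : R[i]) (V : nat -> mpart l -> mxmod (laurent R l)).
Hypothesis eta_prim : e.-primitive_root eta.
Hypothesis v_incr : forall i j : 'I_l, (i < j)%N -> v i < v j.
Hypothesis v_bound : forall i j : 'I_l, v j < v i + e%:R.
Hypothesis V_lattice : forall m la, is_mpart m la -> is_V m la (V m la).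

(** Each of two labels dominates the other, so all partial sums of [kappa] agree, against the
    inequality contained in strict dominance. *)
Lemma label_unique n M la la' :
  is_label s v eta V n M la -> is_label s v eta V n M la' -> la = la'.
Proof.
move=> [pla mla dla] [pla' mla' dla'].
have [//|[[i ne] le]] : dominated s v la la' by apply: dla' => //; rewrite mla.
have [//|[_ ge]] : dominated s v la' la by apply: dla => //; rewrite mla'.
case: ne; have sumE t : \sum_(i < t) kappa s v la i = \sum_(i < t) kappa s v la' i.
  by apply: le_anti; rewrite le ge.
by have := sumE i.+1; rewrite !big_ord_recr /= sumE => /addrI.
Qed.

Lemma labelE n M la : is_label s v eta V n M la -> label s v eta V n M = la.
Proof.
move=> lla; apply: (label_unique _ lla).
exact: (@xgetPex _ _ [set la | is_label s v eta V n M la]%classic (ex_intro _ la lla)).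
Qed.

Lemma eta_neq0 : eta != 0.
Proof. by rewrite (prim_root_eq0 eta_prim) -lt0n (prim_order_gt0 eta_prim). Qed.

Local Notation th := (theta_morphism s eta_neq0).
Local Notation jc := (jcont (@qA R l) (laurent_qV R l) (@QA R l)).

Lemma theta_jcont i x : th (jc i x) = eta ^ (i%:Z + nres s x).
Proof.
have thq : th (@qA R l) = eta by exact: (theta_q s eta_neq0).
have thV : th (laurent_qV R l) = eta^-1.
  have /(congr1 th) := laurent_qqV R l; rewrite rmorphM rmorph1 thq => E.
  by apply: (mulfI eta_neq0); rewrite E mulfV // eta_neq0.
have thQ c : th (@QA R l c) = eta ^ s c by exact: (theta_Q s eta_neq0).
rewrite /jcont /cont !rmorphM !rmorphXn thV thq thQ /nres.
by rewrite !(expfzDr _ _ eta_neq0) -invr_expz exprVn !mulrA.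
Qed.

Lemma label_greedy n (j : 'I_l) (k : int) (w : nat -> 'I_l) : (0 < n)%N ->
  (e%:Z %| s j - k)%Z -> greedy n e s v k w ->
  theta_label s v eta V n (mrow n j) = rows n w.
Proof.
move=> n0 jk gw; apply: labelE; set M := CV _ _ _ _ _.
have l0 : (0 < l)%N by apply: leq_ltn_trans (ltn_ord j).
have pM : is_mpart n (mrow n j) by rewrite mrow_rows; exact: rows_mpart.
have [relM kvM] := V_lattice pM.
have [dimM actM] := mrow_character (laurent_qqV R l) (@laurent_inc_inj R l) (@laurent_generic R l) relM kvM.
pose chi (i : nat) : R[i] := if i == 0%N then eta ^ s j else eta.
have {}actM i : (i < n)%N -> M i = (chi i)%:M.
  move=> lti; rewrite /M /CV /= actM // -[map_mx _ _]/(map_mx th _) map_scalar_mx.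
  rewrite /chi; case: eqP => _; congr (_%:M); [exact: (theta_Q s eta_neq0) | exact: (theta_q s eta_neq0)].
have {}dimM : rdim M = 1%N by exact: dimM.
have thq : th (@qA R l) = eta by exact: (theta_q s eta_neq0).
have chi_q i : (1 <= i < n)%N -> chi i = th (@qA R l).
  by rewrite thq /chi; case: i.
have chijE i : (i < n)%N -> chiw chi (jword i) = eta ^ (s j + (i.*2)%:Z).
  by move=> lti; rewrite (chiw_jword chi_q lti) thq expfzDr // eta_neq0.
have chi_res i x : (i < n)%N ->
    th (jc i x) = chiw chi (jword i) <-> (e%:Z %| nres s x - (k + i%:Z))%Z.
  move=> lti; rewrite theta_jcont chijE // (prim_root_exprz _ _ eta_prim).
  (* The character gives [s j] plus twice [i], and the node gives [i] plus its residue; so the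
     residue sequence of the module starts at [k] and grows by one. *)
  have E : i%:Z + nres s x - (s j + i.*2%:Z) = nres s x - (k + i%:Z) - (s j - k).
    by rewrite -addnn PoszD; ring.
  by rewrite E; split=> h; [rewrite -(subrK (s j - k) (_ - _)); apply: rpredD | apply: rpredB].
have [P1 _ _] := gw.
have res0 (i : 'I_n) : (e%:Z %| nres s (wtab n w i) - (k + i%:Z))%Z.
  by rewrite wtabE /nres /= subr0; exact: P1.
have pw := rows_mpart n w; have [relV kvV] := V_lattice pw.
have std0 : standard (rows n w) (wtab n w).
  by apply: wtab_standard; exact: rearrangement_refl.
split=> //.
- have [_ simV _] := kvV.
  have [ts [P [uts tsP uP Pjm]]] := KV_basis (inc := laurent_inc R l) (laurent_qqV R l) kvV.
  have /tnthP[r0 r0P] : wtab n w \in ts by apply/tsP.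
  apply: (@multiplicity_one _ _ _ (laurent_inc R l) th l n (@qA R l) (laurent_qV R l) (@QA R l)
    (V n (rows n w)) (rows n w) n0 (laurent_qqV R l) (@laurent_inc_inj R l) ts P uts tsP uP Pjm chi w
    (wrank n w) _ relV simV _ _ _ _ _ chi_q _ r0 (esym r0P) M dimM actM).
  + exact: laurent_generic.
  + exact: rows_onerow.
  + exact: wtab_standard.
  + exact: wrank_sorted gw.
  + exact: wrank_inj.
  + move=> t stt t_res.
    have {}t_res (i : 'I_n) : (e%:Z %| nres s (t i) - (k + i%:Z))%Z.
      apply/(chi_res i _ (ltn_ord i)); rewrite t_res.
      exact/(chi_res i _ (ltn_ord i)).
    have le i := npos_le_gpos gw pw stt t_res i.
    apply: (eq_greedy_tableau gw pw stt t_res v_incr v_bound) => i.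
    (* Both tableaux fill the same diagram, so their positions have equal sums; the pointwise
       inequalities are therefore equalities. *)
    have sumE : \sum_(i < n) npos s v (t i) = \sum_(i < n) gpos s v w i.
      under [RHS]eq_bigr => i' _ do rewrite -npos_wtab.
      by rewrite (tableau_sum pw stt _ (leqnn n)) (tableau_sum pw std0 _ (leqnn n)).
    apply: le_anti; rewrite le leNgt; apply/negP => lt.
    have : \sum_(i < n) npos s v (t i) < \sum_(i < n) gpos s v w i.
      rewrite (bigD1 i) //= [ltRHS](bigD1 i) //=; apply: ltr_leD => //.
      by apply: ler_sum => i' _; exact: le.
    by rewrite sumE ltxx.
  + by move=> i; symmetry; apply/(chi_res i _ (ltn_ord i)).
- move=> mu pmu mult; have [relU kvU] := V_lattice pmu.
  have [ts [P [uts tsP uP Pjm]]] := KV_basis (inc := laurent_inc R l) (laurent_qqV R l) kvU.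
  have [t stt t_res] := occurrence (th := th) n0 (@laurent_inc_inj R l) tsP uP Pjm dimM actM mult.
  have {}t_res (i : 'I_n) : (e%:Z %| nres s (t i) - (k + i%:Z))%Z.
    by apply/(chi_res i _ (ltn_ord i)).
  have le i := npos_le_gpos gw pmu stt t_res i.
  have [->|/eqP ne] := eqVneq mu (rows n w); [by left | right].
  have le' i : npos s v (t i) <= npos s v (wtab n w i) by rewrite npos_wtab.
  split; last by move=> N; apply: (kappa_sum_le l0 pmu pw stt std0 le').
  have [i0 lt] : exists i, npos s v (t i) < npos s v (wtab n w i).
    apply: contrapT => none; apply: ne; apply: (eq_mpart pmu pw (t := t)) => //.
    have -> // : t = wtab n w.
    apply: (eq_greedy_tableau gw pmu stt t_res v_incr v_bound) => i.
    apply: le_anti; rewrite le leNgt; apply/negP => lt; apply: none; exists i.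
    by rewrite npos_wtab.
  exact: (kappa_neq l0 pmu pw stt std0 le' lt).
Qed.

End Label.

Theorem proposition6p2 (R : realType) (l n e : nat) (s : 'I_l -> int)
  (v : 'I_l -> rat) (eta : R[i])
  (V : nat -> mpart l -> mxmod (laurent R l)) (alpha : nat -> 'I_l) (k : nat)
  (l_gt0 : (0 < l)%N) (n_gt0 : (0 < n)%N) (e_ge2 : (2 <= e)%N)
  (eta_prim : e.-primitive_root eta)
  (v_incr : forall i j : 'I_l, (i < j)%N -> v i < v j)
  (v_bound : forall i j : 'I_l, v j < v i + e%:R)
  (V_lattice : forall m la, is_mpart m la -> is_V m la (V m la))
  (alphaP : forall k1, res_set e s k1 -> is_alpha e s k1 (alpha k1))
  (k_res : res_set e s k) :
  let lab := theta_label s v eta V in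
  let cond1 :=
    forall k1, res_set e s k1 -> k1 <> k ->
      s (alpha k) > s (alpha k1) \/
      [/\ s (alpha k1) > s (alpha k), s (alpha k) > s (alpha k1) - e%:Z &
          (alpha k < alpha k1)%N] in
  let cond2 k1 :=
    s (alpha k1) > s (alpha k) + e%:Z \/
    [/\ s (alpha k1) > s (alpha k), s (alpha k) > s (alpha k1) - e%:Z &
        (alpha k1 < alpha k)%N] in
  (cond1 -> lab n (mrow n (alpha k)) = mrow n (alpha k)) /\
  (~ cond1 ->
   forall k1, res_set e s k1 -> cond2 k1 ->
     (forall k2, res_set e s k2 -> cond2 k2 ->
        (res_diff e k k1 <= res_diff e k k2)%N) ->
     let j := res_diff e k k1 in
     lab n (mrow n (alpha k)) =
       if (n <= j)%N then mrow n (alpha k)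
       else mpart_add (mrow j (alpha k))
              (lab (n - j)%N (mrow (n - j)%N (alpha k1)))).
Proof.
move=> lab cond1 cond2.
have e0 : (0 < e)%N by apply: ltnW.
have labE m a w : (0 < m)%N -> res_set e s a -> greedy m e s v a%:Z w ->
    lab m (mrow m (alpha a)) = rows m w.
  move=> m0 ra; apply: label_greedy => //; exact: (alpha_mod alphaP).
have labC m : (0 < m)%N ->
    (forall k1, res_set e s k1 -> jumps e s alpha k k1 -> (m <= res_diff e k k1)%N) ->
    lab m (mrow m (alpha k)) = mrow m (alpha k).
  move=> m0 nojump; rewrite (labE m k (fun=> alpha k)) ?mrow_rows //.
  exact: greedy_const.
split=> [c1|_ k1 rk1 jk1 k1min j].
  (* Each alternative of the first condition excludes both ways of jumping. *)
  apply: labC => // k1 rk1 jk1; have := c1 k1 rk1 (jumps_neq e0 jk1).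
  by case: jk1 => [?|[? ? ?]] [?|[? ? ?]]; lia.
have [nj|jn] := leqP n j.
  by apply: labC => // k2 rk2 jk2; apply: leq_trans nj _; exact: k1min.
(* [w] computes the label for the remaining n - j nodes; preceded by [j] letters [alpha k], it is
   the greedy word for [n]. *)
have [w w_0 gw] := greedy_ex e0 v_incr v_bound alphaP (n - j) rk1.
have j0 : (0 < j)%N.
  by apply: (res_diff_gt0 e0 k_res rk1); exact: (jumps_neq e0 jk1).
rewrite (labE (n - j)%N k1 w) ?subn_gt0 // -rows_wcat; last exact: ltnW.
apply: labE => //; apply: (greedy_cat e0 alphaP k_res rk1 j0 jn _ gw w_0).
- by apply: greedy_const => // k2 rk2 jk2; exact: k1min.
- exact: jumps_charge.
- exact: res_diffP.
Qed.
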